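(* Every graph $G$ with a perfect matching admits a Deming decomposition $\{\{B_i\}_{i=1}^{r},\{K_j\}_{j=1}^{\ell},R\}$ (for some $r,\ell\ge 0$).
   Context: Graphs are finite and simple. For a graph $H$, $n(H)$ is its order, $\alpha(H)$ its independence number and $\nu(H)$ its matching number. $H$ is KE (König-Egerváry) if $\alpha(H)+\nu(H)=n(H)$; the null graph is KE. $T$ is the graph on 6 vertices consisting of two vertex-disjoint triangles together with a single edge joining a vertex of one to a vertex of the other. An even subdivision of a graph is obtained by subdividing each edge an even number (possibly zero) of times, i.e. replacing each edge by a path of odd length. A Deming-$K_4$ graph is a graph $K$ that contains a spanning even subdivision of $K_4$ and such that $K-\{x,y\}$ (delete both vertices) is KE for every edge $xy$ of $K$ that lies in at least one perfect matching of $K$. A Deming-BP graph is a graph $B$ that contains a spanning even subdivision of $T$ and such that $B-\{x,y\}$ is KE for every edge $xy$ of $B$ that lies in at least one perfect matching of $B$. A Deming decomposition of a graph $G$ with a perfect matching consists of: (1) a collection of Deming-BP subgraphs $\{B_i\}_{i=1}^r$ of $G$ ($r\ge 0$); (2) a collection of Deming-$K_4$ subgraphs $\{K_j\}_{j=1}^{\ell}$ of $G$ ($\ell\ge 0$); (3) a KE subgraph $R$ of $G$ (possibly null) that has a perfect matching; such that the vertex sets of all these subgraphs partition $V(G)$. *)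

(* Defs.v *)
From mathcomp Require Import all_boot.

Set Implicit Arguments.
Unset Strict Implicit.
Unset Printing Implicit Defensive.

(* Finite simple graphs with vertex set V. *)
Record sgraph (V : finType) := SGraph {
  adj :> rel V;
  adj_sym : symmetric adj;
  adj_irr : irreflexive adj }.

Section Graphs.
Variables (V : finType) (G : sgraph V).

Definition edges : {set {set V}} :=
  [set [set p.1; p.2] | p : V * V & G p.1 p.2].

Definition stable (A : {set V}) : bool :=
  [forall x in A, forall y in A, ~~ G x y].

(* Every member of [edges] is nonempty, so [trivIset M] says that distinct
   members of M are disjoint. *)
Definition matching (M : {set {set V}}) : bool :=
  (M \subset edges) && trivIset M.

Definition perfect_matching (M : {set {set V}}) : bool :=
  matching M && (cover M == [set: V]).

Definition has_perfect_matching : Prop := exists M, perfect_matching M.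

Definition alpha : nat := \max_(A : {set V} | stable A) #|A|.
Definition nu : nat := \max_(M : {set {set V}} | matching M) #|M|.

Definition KE : Prop := alpha + nu = #|V|.

Definition induced_adj (S : {set V}) : rel {x : V | x \in S} :=
  fun x y => G (val x) (val y).

Lemma induced_adj_sym S : symmetric (@induced_adj S).
Proof. by move=> x y; apply: adj_sym. Qed.

Lemma induced_adj_irr S : irreflexive (@induced_adj S).
Proof. by move=> x; apply: adj_irr. Qed.

Definition induced (S : {set V}) : sgraph {x : V | x \in S} :=
  SGraph (@induced_adj_sym S) (@induced_adj_irr S).

Definition delete (A : {set V}) := induced (~: A).

End Graphs.

(* H is obtained from F by replacing every edge uv with a path from phi u to
   phi v whose successive internal vertices are listed by P u v; the number of
   internal vertices is even, i.e. the path has odd length.  Both orientations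
   of an edge of F describe the same path ([esub_rev]).  The values of P at
   non-edges of F are irrelevant. *)
Record is_even_subdivision (U V : finType) (F : sgraph U) (H : sgraph V)
    (phi : U -> V) (P : U -> U -> seq V) : Prop := IsEvenSubdivision {
  esub_inj : injective phi;
  esub_rev : forall u v, F u v -> P v u = rev (P u v);
  esub_even : forall u v, F u v -> ~~ odd (size (P u v));
  esub_uniq : forall u v, F u v -> uniq (P u v);
  esub_internal : forall u v w, F u v -> phi w \notin P u v;
  esub_disjoint : forall u v u' v' z, F u v -> F u' v' ->
    z \in P u v -> z \in P u' v' -> [set u; v] = [set u'; v'];
  esub_vertices : forall z,
    (exists u, z = phi u) \/ (exists u v, F u v /\ z \in P u v);
  (* the zip lists the pairs of consecutive vertices of the path *)
  esub_edges : forall x y, H x y <->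
    exists u v, F u v /\
      (x, y) \in zip (phi u :: P u v) (rcons (P u v) (phi v)) }.

Definition even_subdivision (U V : finType) (F : sgraph U) (H : sgraph V) :
    Prop :=
  exists (phi : U -> V) (P : U -> U -> seq V), is_even_subdivision F H phi P.

Definition has_spanning_even_subdivision (U V : finType) (F : sgraph U)
    (G : sgraph V) : Prop :=
  exists H : sgraph V, subrel H G /\ even_subdivision F H.

Definition K4_adj : rel 'I_4 := fun i j => i != j.

Lemma K4_adj_sym : symmetric K4_adj.
Proof. by move=> i j; rewrite /K4_adj eq_sym. Qed.

Lemma K4_adj_irr : irreflexive K4_adj.
Proof. by move=> i; rewrite /K4_adj eqxx. Qed.

Definition K4 : sgraph 'I_4 := SGraph K4_adj_sym K4_adj_irr.

(* Triangles {0, 1, 2} and {3, 4, 5} joined by the edge 23. *)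
Definition T_adj : rel 'I_6 := fun i j =>
  [|| (i != j) && ((i < 3) == (j < 3)),
      (val i == 2) && (val j == 3) | (val i == 3) && (val j == 2)].

Lemma T_adj_sym : symmetric T_adj.
Proof.
move=> i j; rewrite /T_adj eq_sym [(i < 3) == _]eq_sym.
by rewrite [X in _ || X]orbC ![(val j == _) && _]andbC.
Qed.

Lemma T_adj_irr : irreflexive T_adj.
Proof. by move=> i; rewrite /T_adj eqxx /=; case: (nat_of_ord i) => [|[|[|[|]]]]. Qed.

Definition T : sgraph 'I_6 := SGraph T_adj_sym T_adj_irr.

Definition KE_after_matched_deletion (V : finType) (G : sgraph V) : Prop :=
  forall x y, G x y ->
    (exists M, perfect_matching G M /\ [set x; y] \in M) ->
    KE (delete G [set x; y]).

Definition Deming_K4 (V : finType) (G : sgraph V) : Prop :=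
  has_spanning_even_subdivision K4 G /\ KE_after_matched_deletion G.

Definition Deming_BP (V : finType) (G : sgraph V) : Prop :=
  has_spanning_even_subdivision T G /\ KE_after_matched_deletion G.

(* The parts are the subgraphs of G induced by the given vertex sets.  Induced
   subgraphs are essential: if R could be any subgraph, the edges of a perfect
   matching of G would alone form a decomposition with r = l = 0. *)
Record Deming_decomposition (V : finType) (G : sgraph V) (r l : nat)
    (B : 'I_r -> {set V}) (K : 'I_l -> {set V}) (R : {set V}) : Prop :=
  DemingDecomposition {
  dd_BP : forall i, Deming_BP (induced G (B i));
  dd_K4 : forall j, Deming_K4 (induced G (K j));
  dd_KE : KE (induced G R);
  dd_pm : has_perfect_matching (induced G R);
  (* every vertex lies in exactly one part *)
  dd_partition : forall v : V,
    #|[set i | v \in B i]| + #|[set j | v \in K j]| + (v \in R) = 1 }.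

(* Main.v *)
Require Import Defs.
From mathcomp Require Import all_boot.
From mathcomp Require Import zify.
From Stdlib Require Import Classical.

Set Implicit Arguments.
Unset Strict Implicit.
Unset Printing Implicit Defensive.

(** A matching is encoded as an involution [m]; its edges are the pairs
    [{v, m v}] with [m v != v], and [supp m] is the set of vertices it covers.

    For a graph with a perfect matching, being KE is a 2-satisfiability
    problem: one end of every matching edge has to be chosen so that the chosen
    vertices are independent.  An edge between [v] and [m w] says that choosing
    [v] forces choosing [w].  If no vertex [b] satisfies [b ->* m b ->* b],
    the problem is solvable and the graph is KE ([KE_or_contradiction]).
    Otherwise there is a posy: forcing walks [b ->* m b], [m b ->* c] and
    [c ->* m c], of lengths r, u and s.

    Let S0 carry a perfect matching and not induce a KE graph.  Among all
    matchings [m] inside S0 which have a posy and whose complement in S0 can be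
    perfectly matched, choose one with, in order of priority, the fewest
    covered vertices, the least r + 2u + s, and the least r + s.  Reversing a
    walk or splicing walks together would produce a smaller posy unless the
    following holds.  The walks [b ->* m b] and [c ->* m c] trace odd cycles
    (blossoms) through [b] and [c], simple and saturated by [m] off these tips,
    and the middle walk is an odd path from [b] to [c], the stem, which meets
    them only in their tips ([tight_x_inj] to [tight_zy_mate]).  The two
    blossoms may share matching edges, but all of them are traversed in the
    same relative direction ([tight_nomix]).  They are also met in the same
    order: a closest pair met in opposite orders lies on an alternating even
    cycle, and exchanging matching and nonmatching edges along this cycle
    yields a shorter posy ([no_inversion]).  So either the blossoms are
    disjoint, and with the stem they form an even subdivision of T; or they
    agree, up to parallel detours, on one segment and are disjoint elsewhere,
    and the stem and this segment are opposite rungs of an even subdivision of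
    K4 ([tight_subdivision]).

    As the number of covered vertices is least, this subdivision spans
    [supp m].  For the same reason deleting a matched edge from the graph
    induced by [supp m] leaves a KE graph: otherwise there would be a posy on
    fewer vertices.  So [supp m] is a Deming part, what remains of S0 is again
    perfectly matched, and one concludes by induction ([Deming_parts]). *)

(** * Recognizing even subdivisions *)

Lemma mem_zipC (A B : eqType) (s : seq A) (t : seq B) a b :
  ((b, a) \in zip t s) = ((a, b) \in zip s t).
Proof.
elim: s t => [|c s IH] [|d t] //=.
by rewrite !inE IH !xpair_eqE andbC.
Qed.

Lemma zip_rev_rcons (A : eqType) (a b : A) s x y :
  (x, y) \in zip (a :: s) (rcons s b) ->
  (y, x) \in zip (b :: rev s) (rcons (rev s) a).
Proof.
rewrite -rev_rcons -rev_cons -rev_zip ?size_rcons // mem_rev.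
by rewrite mem_zipC.
Qed.

Lemma path_zip (A : eqType) (e : rel A) a b s x y :
  path e a (rcons s b) -> (x, y) \in zip (a :: s) (rcons s b) -> e x y.
Proof.
elim: s a => [|c s IH] a /=.
  by rewrite andbT inE xpair_eqE => ab /andP[/eqP-> /eqP->].
move=> /andP[ac cp]; rewrite inE xpair_eqE => /orP[/andP[/eqP-> /eqP->]//|].
exact: IH.
Qed.

Lemma uniq_flatten_eq (A B : eqType) (f : A -> seq B) es e e' z :
  uniq (flatten [seq f e | e <- es]) -> e \in es -> e' \in es ->
  z \in f e -> z \in f e' -> e = e'.
Proof.
elim: es => //= e0 es IH; rewrite cat_uniq => /and3P[_ /hasPn no us].
have sub d : d \in es -> z \in f d -> z \notin f e0.
  by move=> din zd; apply: no; apply/flattenP; exists (f d) => //; apply: map_f.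
rewrite !inE => /orP[/eqP->|ein] /orP[/eqP->|ein'] //; last exact: IH.
- by move=> z0 /(sub _ ein'); rewrite z0.
- by move=> /(sub _ ein) /negP n0 /n0.
Qed.

Lemma uniq_flatten_mem (A B : eqType) (f : A -> seq B) es e :
  uniq (flatten [seq f e | e <- es]) -> e \in es -> uniq (f e).
Proof.
elim: es => //= e0 es IH; rewrite cat_uniq inE => /and3P[u0 _ us].
by case/orP => [/eqP->|/(IH us)].
Qed.

(** All the disjointness conditions on an even subdivision amount to one
    list, of the branch vertices [vs] followed by the internal vertices of all
    the paths, being free of duplicates.  The list [es] names each edge of the
    pattern once, by the numbers of its ends in increasing order, so that a
    single path per edge has to be supplied. *)
Lemma spanning_even_subdivisionI (W : finType) (H : sgraph W) n (F : sgraph 'I_n)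
    (w0 : W) (es : seq (nat * nat)) (vs : seq W) (P : nat * nat -> seq W) :
    (forall e, e \in es -> e.1 < e.2 < n) ->
    (forall i j : 'I_n, F i j = ((val i, val j) \in es) || ((val j, val i) \in es)) ->
    size vs = n ->
    uniq (vs ++ flatten [seq P e | e <- es]) ->
    (forall w, w \in vs ++ flatten [seq P e | e <- es]) ->
    (forall e, e \in es -> ~~ odd (size (P e))) ->
    (forall e, e \in es -> path H (nth w0 vs e.1) (rcons (P e) (nth w0 vs e.2))) ->
  has_spanning_even_subdivision F H.
Proof.
move=> eslt FE sz; rewrite cat_uniq => /and3P[uvs /hasPn dis uP] cover even_es path_es.
pose phi (i : 'I_n) := nth w0 vs i.
pose Q (i j : 'I_n) :=
  if (val i, val j) \in es then P (val i, val j) else rev (P (val j, val i)).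
have QE i j : (val i, val j) \in es -> Q i j = P (val i, val j) /\ Q j i = rev (Q i j).
  move=> ij; rewrite /Q ij ifN //; apply/negP => ji.
  by have /andP[ij' _] := eslt _ ij; have /andP[] := eslt _ ji; rewrite ltnNge ltnW.
have QP i j : F i j -> exists2 e, e \in es &
    (e = (val i, val j) /\ Q i j = P e) \/ (e = (val j, val i) /\ Q i j = rev (P e)).
  rewrite FE => /orP[] ij; have [E1 E2] := QE _ _ ij.
    by exists (val i, val j) => //; left.
  by exists (val j, val i) => //; right; rewrite E2 E1.
have Qmem i j e : Q i j = P e \/ Q i j = rev (P e) -> Q i j =i P e.
  by case=> -> z; rewrite ?mem_rev.
have Qrev i j : F i j -> Q j i = rev (Q i j).
  rewrite FE => /orP[] /QE[] // _ ->; exact: esym (revK _).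
have nthvs (i : 'I_n) : phi i \in vs by rewrite mem_nth // sz.
have phi_inj : injective phi.
  by move=> i j /eqP; rewrite nth_uniq ?sz // => /eqP/val_inj.
have Qpath i j : F i j -> path H (phi i) (rcons (Q i j) (phi j)).
  move=> /QP[e ein [] [eE ->]]; first by have := path_es e ein; rewrite eE.
  have -> : rcons (rev (P e)) (phi j) = rev (belast (phi j) (rcons (P e) (phi i))).
    by rewrite belast_rcons rev_cons.
  rewrite -{1}[phi i](last_rcons (phi j) (P e)) rev_path.
  have := path_es e ein; rewrite eE /=; apply: sub_path => v w.
  by rewrite adj_sym.
have Qin i j z : F i j -> z \in Q i j -> exists2 e, e \in es & z \in P e.
  by move=> /QP[e ein [] [_ ->]] zQ; exists e => //; rewrite mem_rev in zQ.
have notvs e z : e \in es -> z \in P e -> z \notin vs.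
  by move=> ein zP; apply: dis; apply/flattenP; exists (P e) => //; apply: map_f.
pose HH v w := [exists i, exists j,
  F i j && ((v, w) \in zip (phi i :: Q i j) (rcons (Q i j) (phi j)))].
have HHP v w : reflect (exists i j, F i j /\
    (v, w) \in zip (phi i :: Q i j) (rcons (Q i j) (phi j))) (HH v w).
  apply: (iffP existsP) => -[i]; first by case/existsP=> j /andP[]; exists i, j.
  by case=> j [ij vw]; exists i; apply/existsP; exists j; rewrite ij.
have HHsub v w : HH v w -> H v w.
  by case/HHP => i [j [/Qpath ij vw]]; apply: path_zip ij vw.
have HHsym : symmetric HH.
  suff imp v w : HH v w -> HH w v by move=> v w; apply/idP/idP; apply: imp.
  case/HHP=> i [j [ij vw]]; apply/HHP; exists j, i; rewrite adj_sym; split=> //.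
  by rewrite (Qrev _ _ ij); apply: zip_rev_rcons.
have HHirr : irreflexive HH.
  by move=> v; case vv: (HH v v) => //; have := HHsub _ _ vv; rewrite adj_irr.
exists (SGraph HHsym HHirr); split; first by move=> v w; apply: HHsub.
exists phi, Q; split=> //.
- move=> i j /QP[e ein [] [_ ->]]; rewrite ?size_rev; exact: even_es.
- move=> i j /QP[e ein [] [_ ->]]; rewrite ?rev_uniq; exact: uniq_flatten_mem uP ein.
- move=> i j k ij; apply/negP => /(Qin _ _ _ ij)[e ein /(notvs _ _ ein)].
  by rewrite nthvs.
- move=> i j i' j' z /QP[e ein ijE] /QP[e' ein' ijE'] zQ zQ'.
  have ze : z \in P e by case: ijE zQ => [] [_ ->]; rewrite ?mem_rev.
  have ze' : z \in P e' by case: ijE' zQ' => [] [_ ->]; rewrite ?mem_rev.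
  have ee := uniq_flatten_eq uP ein ein' ze ze'.
  case: ijE => [] [E _]; case: ijE' => [] [E' _]; move: ee; rewrite E E' =>
    -[] /val_inj-> /val_inj-> //.
  + by rewrite setUC.
  + by rewrite setUC.
- move=> w; have := cover w; rewrite mem_cat => /orP[wv|/flattenP[p /mapP[e ein ->] wp]].
    have iw : index w vs < n by rewrite -sz index_mem.
    by left; exists (Ordinal iw); rewrite /phi /= nth_index.
  have /andP[lt12 lt2] := eslt _ ein.
  have lt1 := ltn_trans lt12 lt2.
  right; exists (Ordinal lt1), (Ordinal lt2).
  have ein' : (val (Ordinal lt1), val (Ordinal lt2)) \in es by rewrite /= -surjective_pairing.
  by rewrite FE ein' (proj1 (QE _ _ ein')) /= -surjective_pairing.
- by move=> v w; split=> [/HHP|vw] //; apply/HHP.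
Qed.

Lemma pmap_insub_val (V : finType) (S : {set V}) (s : seq V) :
  {subset s <= S} -> map val (pmap insub s : seq {v | v \in S}) = s.
Proof.
move=> sub; rewrite pmap_filter; last exact: insubK.
by apply/all_filterP/allP => v /sub vS; rewrite isSome_insub.
Qed.

Lemma induced_even_subdivisionI (V : finType) (G : sgraph V) n (F : sgraph 'I_n)
    (S : {set V}) (es : seq (nat * nat)) (v0 : V) (vs : seq V) (P : nat * nat -> seq V) :
    v0 \in S ->
    (forall e, e \in es -> e.1 < e.2 < n) ->
    (forall i j : 'I_n, F i j = ((val i, val j) \in es) || ((val j, val i) \in es)) ->
    size vs = n ->
    uniq (vs ++ flatten [seq P e | e <- es]) ->
    (forall w, (w \in vs ++ flatten [seq P e | e <- es]) = (w \in S)) ->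
    (forall e, e \in es -> ~~ odd (size (P e))) ->
    (forall e, e \in es -> path G (nth v0 vs e.1) (rcons (P e) (nth v0 vs e.2))) ->
  has_spanning_even_subdivision F (induced G S).
Proof.
move=> v0S eslt FE sz uL LE even_es path_es.
pose lift (s : seq V) : seq {v | v \in S} := pmap insub s.
have vsS : {subset vs <= S} by move=> w wv; rewrite -LE mem_cat wv.
have PS e : e \in es -> {subset P e <= S}.
  move=> ein w wP; rewrite -LE mem_cat; apply/orP; right.
  by apply/flattenP; exists (P e) => //; apply: map_f.
have liftK s : {subset s <= S} -> map val (lift s) = s := @pmap_insub_val _ S s.
have lsize s : {subset s <= S} -> size (lift s) = size s.
  by move=> /liftK {2}<-; rewrite size_map.
have E : map val (lift vs ++ flatten [seq lift (P e) | e <- es]) =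
    vs ++ flatten [seq P e | e <- es].
  rewrite map_cat liftK // map_flatten -map_comp; congr (_ ++ flatten _).
  by apply/eq_in_map => e ein /=; apply/liftK/PS.
apply: (@spanning_even_subdivisionI _ _ _ _ (Sub v0 v0S) es (lift vs) (fun e => lift (P e))) => //.
- by rewrite lsize.
- by rewrite -(map_inj_uniq val_inj) E.
- by move=> w; rewrite -(mem_map val_inj) E LE; apply: valP.
- by move=> e ein; rewrite lsize ?even_es //; apply: PS.
- move=> e ein; have /andP[lt12 lt2] := eslt _ ein; have := path_es e ein.
  have nthE k : k < n -> nth v0 vs k = val (nth (Sub v0 v0S) (lift vs) k).
    by move=> kn; rewrite -(nth_map _ v0) ?liftK ?lsize ?sz.
  rewrite !nthE ?(ltn_trans lt12) // -{1}(liftK (P e)); last exact: PS.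
  by rewrite -map_rcons path_map.
Qed.

(** * Matchings as involutions, forcing walks and posies *)

(** Extremal choices below are made among witnesses of undecided
    properties, whence the classical form of the least number principle. *)
Lemma ex_least (P : nat -> Prop) :
  (exists n, P n) -> exists2 n, P n & forall k, P k -> n <= k.
Proof.
case=> n; elim/ltn_ind: n => n IH Pn.
case: (classic (exists2 k, k < n & P k)) => [[k lt_kn]|no]; first exact: IH.
exists n => // k Pk; rewrite leqNgt; apply/negP => lt_kn.
by apply: no; exists k.
Qed.

Section Walks.
Variables (V : finType) (G : sgraph V).
Implicit Types (m : V -> V) (f : nat -> V) (a b c v w : V).

(** Vertices fixed by [m] are the uncovered ones, so that one function records
    both a matching and the set it covers. *)
Definition is_matching m := involutive m /\ forall v, m v != v -> G v (m v).

Definition supp m := [set v | m v != v].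

(** If a set contains exactly one end of every matching edge, is stable and
    contains [a], then it misses the neighbour [m b] of [a] and so contains
    [b]. *)
Definition forces m a b := [&& m a != a, m b != b & G a (m b)].

Definition walk m f n := forall i, i < n -> forces m (f i) (f i.+1).

Definition linked m n a b := exists f, [/\ walk m f n, f 0 = a & f n = b].

(** Two closing walks [b ->* m b] and [c ->* m c] with a stem between their
    tips.  By contraposition the stem also gives [m c ->* b], so the vertices
    [b] and [m b] force each other. *)
Definition posy m r u s := exists b c,
  [/\ m b != b, m c != c, linked m r b (m b), linked m u (m b) c
    & linked m s c (m c)].

Lemma linked0 m a : linked m 0 a a.
Proof. by exists (fun=> a); split. Qed.

Lemma linked_forces m a b : forces m a b -> linked m 1 a b.
Proof.
by move=> ab; exists (fun i => if i is 0 then a else b); split=> // -[|i].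
Qed.

Lemma linked_cat m n1 n2 a b c :
  linked m n1 a b -> linked m n2 b c -> linked m (n1 + n2) a c.
Proof.
move=> [f [fw fa fb]] [g [gw gb gc]].
exists (fun i => if i <= n1 then f i else g (i - n1)); split=> //; last first.
  case: ifP => [le|_]; last by rewrite addKn.
  have n20 : n2 = 0 by lia.
  by rewrite n20 addn0 fb -gb -gc n20.
move=> i; case: (ltngtP i n1) => [lt _|gt lti|-> lti].
- exact: fw.
- by rewrite subSn 1?ltnW //; apply: gw; lia.
- by rewrite subSn // subnn fb -gb; apply: gw; lia.
Qed.

Lemma linked_sub m f n i j : walk m f n -> i <= j <= n -> linked m (j - i) (f i) (f j).
Proof.
move=> fw /andP[le1 le2]; exists (fun k => f (i + k)); split.
- by move=> k lt; rewrite addnS; apply: fw; lia.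
- by rewrite addn0.
- by congr f; lia.
Qed.

Lemma linked_down m f i j : i <= j ->
  (forall k, i <= k < j -> forces m (f k.+1) (f k)) -> linked m (j - i) (f j) (f i).
Proof.
move=> le fw; exists (fun k => f (j - k)); split.
- move=> k lt; have -> : j - k = (j - k.+1).+1 by lia.
  by apply: fw; lia.
- by rewrite subn0.
- by congr f; lia.
Qed.

Lemma eq_linked m n n' a a' b b' :
  linked m n a b -> n = n' -> a = a' -> b = b' -> linked m n' a' b'.
Proof. by move=> ? <- <- <-. Qed.

Lemma walk_supp m f n i : walk m f n -> 0 < n -> i <= n -> m (f i) != f i.
Proof.
move=> fw n0; case: i => [|i] le; last by case/and3P: (fw i le).
by case/and3P: (fw 0 n0).
Qed.

Section Mirror.
Variable m : V -> V.
Hypothesis mm : is_matching m.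

Lemma matchingK : involutive m. Proof. by case: mm. Qed.

Lemma matching_neq v : (m (m v) != m v) = (m v != v).
Proof. by rewrite matchingK eq_sym. Qed.

(** Contraposition of an implication between literals. *)
Lemma forces_mirror a b : forces m a b -> forces m (m b) (m a).
Proof.
by rewrite /forces !matching_neq matchingK => /and3P[-> -> ab]; rewrite adj_sym.
Qed.

Definition mirror f n i := m (f (n - i)).

Lemma walk_mirror f n : walk m f n -> walk m (mirror f n) n.
Proof.
move=> fw i lt; rewrite /mirror; have -> : n - i = (n - i.+1).+1 by lia.
by apply: forces_mirror; apply: fw; lia.
Qed.

Lemma linked_mirror n a b : linked m n a b -> linked m n (m b) (m a).
Proof.
move=> [f [fw <- <-]]; exists (mirror f n); split.
- exact: walk_mirror.
- by rewrite /mirror subn0.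
- by rewrite /mirror subnn.
Qed.

End Mirror.

(** A simple forcing cycle [f 0 -> f 1 -> ... -> f l = f 0] is an alternating
    even cycle of the graph, with matching edges [{f i, m (f i)}] and other
    edges [{f i, m (f i.+1)}].  The matching [m'] uses the latter instead. *)
Lemma switch m f l :
    is_matching m -> walk m f l -> 0 < l -> f l = f 0 ->
    (forall i j, i < j < l -> f i <> f j) ->
    (forall i j, i < l -> j < l -> f i <> m (f j)) ->
  exists m', [/\ is_matching m', supp m' = supp m,
    forall i, i < l -> m' (f i) = m (f i.+1) &
    forall v, (forall i, i < l -> v <> f i /\ v <> m (f i)) -> m' v = m v].
Proof.
move=> mm fw l0 fl finj fm.
have K := matchingK mm.
pose zs := mkseq f l.
have zsP v : reflect (exists2 i, i < l & v = f i) (v \in zs).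
  apply: (iffP mapP) => -[i]; first by rewrite mem_iota => /andP[_ ?] ->; exists i.
  by move=> lt ->; exists i => //; rewrite mem_iota.
have uzs : uniq zs.
  rewrite map_inj_in_uniq ?iota_uniq // => i j.
  rewrite !mem_iota !add0n /= => il jl eqf.
  by case: (ltngtP i j) => // lt; [case: (@finj i j) | case: (@finj j i)]; rewrite ?lt.
have nextf i : i < l -> next zs (f i) = f i.+1.
  move=> lt; rewrite next_nth.
  have -> : f i \in zs by apply/zsP; exists i.
  have ix : index (f i) zs = i.
    by rewrite -[X in index X](nth_mkseq (f 0) f lt) index_uniq ?size_mkseq.
  case E : zs ix => [|z zs'] ix; first by move: lt; rewrite -(size_mkseq f l) -/zs E.
  have zE : z = f 0 by rewrite -[z]/(nth (f 0) (z :: zs') 0) -E nth_mkseq.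
  rewrite ix zE -[nth (f 0) zs' i]/(nth (f 0) (z :: zs') i.+1) -E.
  case: (ltnP i.+1 l) => [lt'|ge]; first by rewrite nth_mkseq.
  by rewrite nth_default ?size_mkseq // -fl; congr f; lia.
have mzs v : v \in zs -> m v \in zs = false.
  move=> /zsP[i il ->]; apply/negP => /zsP[j jl E].
  by apply: (fm j i jl il).
have nzs v : (next zs v \in zs) = (v \in zs) by apply: mem_next.
have pzs v : (prev zs v \in zs) = (v \in zs) by apply: mem_prev.
pose m' v := if v \in zs then m (next zs v)
             else if m v \in zs then prev zs (m v) else m v.
have fsupp v : v \in zs -> m v != v.
  by move=> /zsP[i il ->]; apply: walk_supp fw l0 (ltnW il).
have m'in v : v \in zs -> m' v = m (next zs v) by rewrite /m' => ->.
have m'mate v : v \in zs -> m' (m v) = prev zs v.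
  by move=> vz; rewrite /m' mzs // K vz.
have m'off v : v \notin zs -> m v \notin zs -> m' v = m v.
  by rewrite /m' => /negbTE-> /negbTE->.
have m'K : involutive m'.
  move=> v; case: (boolP (v \in zs)) => vz.
    by rewrite (m'in v) // m'mate ?nzs // prev_next.
  case: (boolP (m v \in zs)) => mvz; last by rewrite !m'off ?K.
  have -> : m' v = prev zs (m v) by rewrite -(m'mate _ mvz) K.
  by rewrite m'in ?pzs // next_prev // K.
have m'ne v : (m' v != v) = (m v != v).
  case: (boolP (v \in zs)) => vz.
    rewrite m'in // fsupp //; apply/eqP => E.
    by have := mzs (next zs v); rewrite E nzs vz => /(_ isT).
  case: (boolP (m v \in zs)) => mvz; last by rewrite m'off.
  have -> : m' v = prev zs (m v) by rewrite -(m'mate _ mvz) K.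
  rewrite -(matching_neq mm) fsupp //.
  by apply/eqP => E; have := pzs (m v); rewrite E (negbTE vz) mvz.
exists m'; split.
- split=> // v; rewrite m'ne => mv.
  case: (boolP (v \in zs)) => [vz|vz].
    rewrite m'in //; case/zsP: vz => i il ->; rewrite nextf //.
    by case/and3P: (fw i il).
  case: (boolP (m v \in zs)) => mvz; last by rewrite m'off //; case: mm => _; apply.
  have -> : m' v = prev zs (m v) by rewrite -(m'mate _ mvz) K.
  have /zsP[j jl Ej] : prev zs (m v) \in zs by rewrite pzs.
  rewrite Ej.
  have <- : m (f j.+1) = v by rewrite -nextf // -Ej next_prev ?K.
  by rewrite adj_sym; case/and3P: (fw j jl).
- by apply/setP => v; rewrite !inE m'ne.
- by move=> i il; rewrite m'in ?nextf //; apply/zsP; exists i.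
- move=> v off; apply: m'off.
    by apply/zsP => -[i /off[]].
  by apply/zsP => -[i /off[_ nv] E]; apply: nv; rewrite -E K.
Qed.

End Walks.

(** * A graph with a perfect matching and no contradictory vertex is KE *)

Section Mates.
Variables (V : finType) (G : sgraph V).
Implicit Types (A : {set V}) (M : {set {set V}}).

Definition mating (m : V -> V) := involutive m /\ forall v, G v (m v).

Lemma perfect_matching_mating M : perfect_matching G M ->
  exists2 m, mating m & forall v w, v != w -> [set v; w] \in M -> m v = w.
Proof.
move=> /andP[/andP[/subsetP Me /trivIsetP tM] /eqP cM].
have ex v : exists w, (w != v) && ([set v; w] \in M).
  have : v \in cover M by rewrite cM inE.
  case/bigcupP => e eM; have /imsetP[[a b] /[!inE] /= ab E] := Me _ eM.
  rewrite E !inE => /orP[]/eqP->.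
    exists b; rewrite -E eM andbT; apply/eqP => ba.
    by rewrite ba adj_irr in ab.
  exists a; rewrite setUC -E eM andbT; apply/eqP => ba.
  by rewrite ba adj_irr in ab.
pose m v := xchoose (ex v).
have mP v : (m v != v) && ([set v; m v] \in M) := xchooseP (ex v).
have uniq_mate v w : w != v -> [set v; w] \in M -> m v = w.
  move=> wv vwM; have /andP[mv mvM] := mP v.
  have E : [set v; m v] = [set v; w].
    apply: contraTeq (set21 v w) => /(tM _ _ mvM vwM).
    rewrite -setI_eq0 => /eqP/setP/(_ v); rewrite !inE eqxx /=.
    by [].
  by have /setP/(_ (m v)) := E; rewrite !inE eqxx orbT (negbTE mv) /= => /esym/eqP.
exists m => [|v w vw]; last by apply: uniq_mate; rewrite eq_sym.
split=> v; have /andP[mv mvM] := mP v.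
  by apply: uniq_mate; rewrite 1?setUC // eq_sym.
have /imsetP[[a b] /[!inE] /= ab /setP E] := Me _ mvM.
have := E v; have := E (m v); rewrite !inE !eqxx orbT /= => /esym/orP[]/eqP Em /esym/orP[]/eqP Ev.
- by rewrite Em -Ev eqxx in mv.
- by rewrite Em Ev adj_sym.
- by rewrite Em Ev.
- by rewrite Em -Ev eqxx in mv.
Qed.

Definition mate_edges (m : V -> V) : {set {set V}} := [set [set v; m v] | v : V].

Lemma mating_perfect m : mating m -> perfect_matching G (mate_edges m).
Proof.
move=> [K adjm]; apply/andP; split; first (apply/andP; split).
- apply/subsetP => e /imsetP[v _ ->].
  by apply/imsetP; exists (v, m v); rewrite ?inE /=.
- apply/trivIsetP => e e' /imsetP[v _ ->] /imsetP[w _ ->].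
  apply: contraR => /pred0Pn[a /=]; rewrite !inE => /andP[/orP[]/eqP-> /orP[]/eqP E].
  + by rewrite E.
  + by rewrite E K setUC.
  + by rewrite -E K setUC.
  + by rewrite (can_inj K E).
- apply/eqP/setP => v; rewrite inE; apply/bigcupP; exists [set v; m v]; last by rewrite set21.
  exact: imset_f.
Qed.

(** Every matching edge has an end outside the stable set. *)
Lemma matching_stable_le A M : stable G A -> matching G M -> #|A| + #|M| <= #|V|.
Proof.
move=> /forall_inP sA /andP[/subsetP Me /trivIsetP tM].
rewrite -(cardsC A) leq_add2l.
have ex e : e \in M -> exists v, (v \in e) && (v \notin A).
  move=> /Me/imsetP[[a b] /[!inE] /= ab ->].
  case: (boolP (a \in A)) => aA; last by exists a; rewrite set21.
  exists b; rewrite set22 /=; apply/negP => bA.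
  by have /forall_inP/(_ b bA) := sA a aA; rewrite ab.
pose g (e : {set V}) : option V := [pick v | (v \in e) && (v \notin A)].
have gP e : e \in M -> exists2 v, g e = Some v & (v \in e) && (v \notin A).
  move=> /ex[w wP]; rewrite /g; case: pickP => [v vP|/(_ w)]; first by exists v.
  by rewrite wP.
have g_inj : {in M &, injective g}.
  move=> e e' eM eM' E; have [v gv /andP[ve _]] := gP _ eM.
  have [v' gv' /andP[ve' _]] := gP _ eM'.
  move: gv'; rewrite -E gv => -[vv]; rewrite -vv in ve'.
  apply: contraTeq ve => /(tM _ _ eM eM') /pred0P/(_ v) /=.
  by rewrite ve' andbT => ->.
rewrite -(card_in_imset g_inj) -(card_imset (mem (~: A)) (@Some_inj _)).
apply/subset_leq_card/subsetP => _ /imsetP[e /gP[v -> /andP[_ vA]] ->].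
by apply: imset_f; rewrite /= inE.
Qed.

Lemma KE_of_stable_transversal m A : mating m -> stable G A ->
  (forall v, (m v \in A) = (v \notin A)) -> KE G.
Proof.
move=> mm sA AC; have [K adjm] := mm.
have bound M A' : stable G A' -> matching G M -> #|A'| + #|M| <= #|V|.
  exact: matching_stable_le.
have le : alpha G + nu G <= #|V|.
  have nuV : nu G <= #|V|.
    by apply/bigmax_leqP => M mM; have := bound M _ sA mM; lia.
  suff : alpha G <= #|V| - nu G by lia.
  apply/bigmax_leqP => A' sA'.
  suff : nu G <= #|V| - #|A'|.
    by have : #|A'| <= #|V| by [apply: max_card]; lia.
  by apply/bigmax_leqP => M mM; have := bound M _ sA' mM; lia.
have aA : #|A| <= alpha G by exact: (@leq_bigmax_cond _ (stable G) (fun A : {set V} => #|A|) A sA).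
have pM := mating_perfect mm; have /andP[mM /eqP cM] := pM.
have nM : #|mate_edges m| <= nu G.
  by exact: (@leq_bigmax_cond _ (matching G) (fun M : {set {set V}} => #|M|) _ mM).
have cov : #|V| <= #|mate_edges m| * 2.
  rewrite -cardsT -cM -sum_nat_const.
  apply: leq_trans (leq_card_cover _) _; apply: leq_sum => e /imsetP[v _ ->].
  by rewrite cards2; case: (v != m v).
have half : #|A|.*2 = #|V|.
  rewrite -(cardsC A) -addnn; congr addn.
  rewrite -(card_imset (mem A) (can_inj K)); apply: eq_card => v.
  rewrite !inE -AC -{1}(K v) mem_imset //; exact: can_inj K.
by apply/eqP; rewrite eqn_leq le; lia.
Qed.

(** Solvability of 2-satisfiability without contradictory variables: a largest
    consistent set [A] closed under forcing contains an end of every matching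
    edge.  Indeed, if it contains neither [v] nor [m v], one of the two does not
    force the other, and everything forced by that one can be added to [A]. *)
Lemma KE_or_contradiction m : mating m ->
  KE G \/ exists v, connect (forces G m) v (m v) /\ connect (forces G m) (m v) v.
Proof.
move=> mm; have [K adjm] := mm.
have mne v : m v != v by apply/eqP => E; have := adjm v; rewrite E adj_irr.
have mm' : is_matching G m by split.
pose R := connect (forces G m).
have Rmirror v w : R v w -> R (m w) (m v).
  move=> /connectP[p pp ->] {w}; elim: p v pp => [|w p IH] v /=; first by move=> _; exact: connect0.
  move=> /andP[vw /IH h]; apply: connect_trans h (connect1 _).
  exact: forces_mirror.
case: (classic (exists v, R v (m v) /\ R (m v) v)) => [|no]; [by right|left].
pose ok (A : {set V}) := [forall v in A, [forall w, R v w ==> (w \in A)]]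
  && [forall v in A, m v \notin A].
have okP A : ok A <-> (forall v w, v \in A -> R v w -> w \in A) /\
    (forall v, v \in A -> m v \notin A).
  split=> [/andP[/forall_inP h1 /forall_inP h2]|[h1 h2]].
    by split=> // v w /h1/forallP/(_ w)/implyP.
  apply/andP; split; apply/forall_inP => v vA; last exact: h2.
  by apply/forallP => w; apply/implyP; apply: h1.
have ok0 : ok set0 by apply/okP; split=> v; rewrite ?inE // => w; rewrite inE.
case: (@arg_maxnP _ set0 ok (fun A => #|A|) ok0) => A /okP[clA consA] maxA.
have total v : (v \in A) || (m v \in A).
  apply/negPn/negP; rewrite negb_or => /andP[vA mvA].
  wlog nv : v vA mvA / ~ R v (m v).
    move=> wl; case: (classic (R v (m v))) => [h|]; last exact: wl.
    apply: (wl (m v)); rewrite ?K // => h'; apply: no; exists v; split=> //.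
  have : ok (A :|: [set w | R v w]).
    apply/okP; split=> [w w'|w]; rewrite !inE.
      move=> /orP[wA|vw] ww'; first by rewrite (clA w).
      by apply/orP; right; apply: connect_trans vw ww'.
    have mA w' : R v w' -> m w' \notin A.
      by move=> /Rmirror vw; apply/negP => /clA/(_ vw); rewrite (negbTE mvA).
    move=> /orP[wA|vw]; rewrite negb_or.
      rewrite consA //=; apply/negP => /mA; rewrite K wA //.
    rewrite mA //=; apply/negP => vmw; apply: nv.
    by apply: connect_trans vw _; rewrite -{1}[w]K; apply: Rmirror.
  move=> /maxA; apply/negP; rewrite -ltnNge; apply: proper_card.
  apply/properP; split; first exact: subsetUl.
  by exists v; rewrite // !inE /R connect0 orbT.
have AC v : (m v \in A) = (v \notin A).
  apply/idP/idP => [h|nv]; last by have := total v; rewrite (negbTE nv).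
  by have := consA _ h; rewrite K.
apply: (KE_of_stable_transversal mm _ AC).
apply/forall_inP => v vA; apply/forall_inP => w wA; apply/negP => vw.
have : m w \in A.
  by apply: clA vA (connect1 _); rewrite /forces !mne K.
by rewrite AC wA.
Qed.

Lemma connect_linked m v w : connect (forces G m) v w -> exists n, linked G m n v w.
Proof.
move=> /connectP[p pp ->] {w}; elim: p v pp => [|w p IH] v /=.
  by exists 0; apply: linked0.
move=> /andP[vw /IH[n wn]]; exists (1 + n).
exact: linked_cat (linked_forces vw) wn.
Qed.

End Mates.

(** The posy is expressed in the ambient graph [G] because posies of different
    induced subgraphs have to be compared; [f] is an embedding of [H] in [G]. *)
Lemma KE_or_posy (V W : finType) (G : sgraph V) (H : sgraph W) (f : W -> V) m :
    injective f -> (forall v w, H v w -> G (f v) (f w)) -> mating H m ->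
  KE H \/ exists m1, [/\ is_matching G m1, supp m1 = [set f w | w : W]
    & exists r u s, posy G m1 r u s].
Proof.
move=> finj fH mm; have [K adjm] := mm.
case: (KE_or_contradiction mm) => [|[b [bm mb]]]; [by left|right].
pose m1 v := if [pick w | f w == v] is Some w then f (m w) else v.
have m1f w : m1 (f w) = f (m w).
  rewrite /m1; case: pickP => [w' /eqP/finj->//|/(_ w)].
  by rewrite eqxx.
have m1n v : (forall w, f w != v) -> m1 v = v.
  by rewrite /m1; case: pickP => // w /eqP <- /(_ w); rewrite eqxx.
have mne w : m w != w by apply/eqP => E; have := adjm w; rewrite E adj_irr.
have dec v : (exists w, v = f w) \/ (forall w, f w != v).
  case: (pickP (fun w => f w == v)) => [w /eqP<-|no]; first by left; exists w.
  by right=> w; rewrite no.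
exists m1; split.
- split=> v; case: (dec v) => [[w ->]|no].
  + by rewrite !m1f K.
  + by rewrite !m1n.
  + by rewrite m1f => _; apply: fH.
  + by rewrite m1n // eqxx.
- apply/setP => v; rewrite inE; case: (dec v) => [[w ->]|no].
    by rewrite m1f (inj_eq finj) mne imset_f.
  rewrite m1n // eqxx; symmetry; apply/imsetP => -[w _ E].
  by have := no w; rewrite E eqxx.
- have lift n v w : linked H m n v w -> linked G m1 n (f v) (f w).
    move=> [g [gw <- <-]]; exists (f \o g); split=> // i /gw.
    rewrite /forces /= !m1f !(inj_eq finj) => /and3P[-> -> /=]; exact: fH.
  have [r br] := connect_linked bm; have [s sb] := connect_linked mb.
  exists r, 0, s, (f b), (f (m b)); rewrite !m1f K; split.
  + by rewrite (inj_eq finj) mne.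
  + by rewrite (inj_eq finj) eq_sym mne.
  + exact: lift.
  + exact: linked0.
  + exact: lift.
Qed.

(** * Least posies consist of two blossoms and a stem *)

Section Tight.
Variables (V : finType) (G : sgraph V).
Implicit Types (m : V -> V) (f x y z : nat -> V) (a b c v w : V).

(** The walks [x], [y], [z] of a posy that is least among the posies of all
    matchings covering the same vertices.  The stem counts twice as it is also
    traversed backwards in the closed walk through [b] and [m b]; the secondary
    condition prefers long stems to long blossoms. *)
Record tight m r u s x y z : Prop := Tight {
  tight_m : is_matching G m;
  tight_x : walk G m x r;
  tight_y : walk G m y u;
  tight_z : walk G m z s;
  tight_xr : x r = m (x 0);
  tight_y0 : y 0 = m (x 0);
  tight_yu : y u = z 0;
  tight_zs : z s = m (z 0);
  tight_b : m (x 0) != x 0;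
  tight_c : m (z 0) != z 0;
  tight_min : forall m' r' u' s',
    is_matching G m' -> supp m' = supp m -> posy G m' r' u' s' ->
    r + u.*2 + s <= r' + u'.*2 + s' /\
    (r' + u'.*2 + s' = r + u.*2 + s -> r + s <= r' + s') }.

Section Facts.
Variables (m : V -> V) (r u s : nat) (x y z : nat -> V).
Hypothesis t : tight m r u s x y z.

Let K : involutive m. Proof. exact: matchingK (tight_m t). Qed.
Let mirr := linked_mirror (tight_m t).

Lemma tight_le r' u' s' : posy G m r' u' s' ->
  r + u.*2 + s <= r' + u'.*2 + s' /\
    (r' + u'.*2 + s' = r + u.*2 + s -> r + s <= r' + s').
Proof. by move=> p; apply: (tight_min t) p => //; apply: tight_m t. Qed.

Lemma tight_r : 1 < r.
Proof.
case: t => mm xw _ _ xr _ _ _ xb _ _; case: r xr xw => [|[|r']] // xr xw.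
  by rewrite -xr eqxx in xb.
by have /and3P[_ _] := xw 0 isT; rewrite xr K adj_irr.
Qed.

Lemma tight_xsupp i : i <= r -> m (x i) != x i.
Proof. by move=> le; apply: (walk_supp (tight_x t)) => //; have := tight_r; lia. Qed.

(** A blossom may be traversed in either direction. *)
Lemma tight_mirrorx : tight m r u s (mirror m x r) y z.
Proof.
case: (t) => mm xw yw zw xr y0 yu zs xb zc tmin; split=> //.
- exact: walk_mirror.
- by rewrite /mirror subnn subn0 xr K.
- by rewrite /mirror subn0 xr K.
- by rewrite /mirror subn0 xr !K.
Qed.

Lemma tight_mirrorz : tight m r u s x y (mirror m z s).
Proof.
case: (t) => mm xw yw zw xr y0 yu zs xb zc tmin; split=> //.
- exact: walk_mirror.
- by rewrite /mirror subn0 zs K.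
- by rewrite /mirror subnn subn0 zs K.
- by rewrite /mirror subn0 zs !K.
Qed.

(** The two blossoms play symmetric roles, the stem being reversed. *)
Lemma tight_swap : tight m s u r z (mirror m y u) x.
Proof.
case: (t) => mm xw yw zw xr y0 yu zs xb zc tmin; split=> //.
- exact: walk_mirror.
- by rewrite /mirror subn0 yu.
- by rewrite /mirror subnn y0 K.
- move=> m' r' u' s' mm' sm' p.
  by have := tmin m' r' u' s' mm' sm' p; lia.
Qed.

Lemma tight_x_inj i j : i < j -> j <= r -> x i <> x j.
Proof.
move=> ij jr E; have [] := @tight_le (i + (r - j)) u s; last by lia.
exists (x 0), (z 0); split; try by case: t.
- apply: (@linked_cat _ _ _ _ _ _ (x i)).
    by apply: eq_linked (linked_sub (i := 0) (j := i) (tight_x t) _) _ _ _; rewrite ?subn0 //; lia.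
  rewrite E -(tight_xr t); apply: linked_sub (tight_x t) _; lia.
- by exists y; case: t.
- by exists z; case: t.
Qed.

Lemma linked_x i j : i <= j <= r -> linked G m (j - i) (x i) (x j).
Proof. exact: linked_sub (tight_x t). Qed.
Lemma linked_y i j : i <= j <= u -> linked G m (j - i) (y i) (y j).
Proof. exact: linked_sub (tight_y t). Qed.
Lemma linked_z i j : i <= j <= s -> linked G m (j - i) (z i) (z j).
Proof. exact: linked_sub (tight_z t). Qed.
Lemma linked_yu : linked G m u (m (x 0)) (z 0).
Proof. by exists y; case: t. Qed.
Lemma linked_zs : linked G m s (z 0) (m (z 0)).
Proof. by exists z; case: t. Qed.
Lemma linked_xr : linked G m r (x 0) (m (x 0)).
Proof. by exists x; case: t. Qed.

(** A smaller blossom inside the walk [x], with tip [x i], can be attached to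
    the stem by following [x] forwards from [x j] or backwards from [x i].
    The lengths of the two resulting posies add up to twice the least length,
    so both are least, but their blossoms are shorter. *)
Lemma tight_x_mate i j : i < j -> j <= r -> 0 < i \/ j < r -> x j <> m (x i).
Proof.
move=> ij jr nends E.
have bl : linked G m (j - i) (x i) (m (x i)) by rewrite -E; apply: linked_x; lia.
have supp_i : m (x i) != x i by apply: tight_xsupp; lia.
have p1 : posy G m (j - i) ((r - j) + u) s.
  exists (x i), (z 0); split=> //; [by case: t| |exact: linked_zs].
  rewrite -E; apply: linked_cat linked_yu.
  by rewrite -(tight_xr t); apply: linked_x; lia.
have p2 : posy G m (j - i) (i + u) s.
  exists (x i), (z 0); split=> //; [by case: t| |exact: linked_zs].
  apply: linked_cat linked_yu; apply: mirr.
  by apply: eq_linked (linked_x (i := 0) (j := i) _) _ _ _ => //; lia.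
have [] := tight_le p1; have [] := tight_le p2; lia.
Qed.

Lemma tight_y_inj i j : i < j -> j <= u -> y i <> y j.
Proof.
move=> ij jr E; have [] := @tight_le r (i + (u - j)) s; last by lia.
exists (x 0), (z 0); split; try by case: t.
- exact: linked_xr.
- apply: (@linked_cat _ _ _ _ _ _ (y i)).
    by rewrite -(tight_y0 t); apply: eq_linked (linked_y (i := 0) (j := i) _) _ _ _ => //; lia.
  by rewrite E -(tight_yu t); apply: linked_y; lia.
- exact: linked_zs.
Qed.

(** The stem would already close a blossom at [y i]. *)
Lemma tight_y_mate i j : i < j -> j <= u -> y j <> m (y i).
Proof.
move=> ij jr E; have [] := @tight_le r i (j - i); last by lia.
exists (x 0), (y i); split; try by case: t.
- by apply: (walk_supp (tight_y t)); lia.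
- exact: linked_xr.
- by rewrite -(tight_y0 t); apply: eq_linked (linked_y (i := 0) (j := i) _) _ _ _ => //; lia.
- by rewrite -E; apply: linked_y; lia.
Qed.

Lemma tight_ysupp i : i <= u -> m (y i) != y i.
Proof.
move=> le; case: (posnP u) => [u0|]; last by move/(walk_supp (tight_y t)); apply.
have -> : i = 0 by lia.
by rewrite (tight_y0 t) K eq_sym; case: t.
Qed.

Lemma tight_y_sep i j : i <= u -> j <= u -> y i <> m (y j).
Proof.
move=> iu ju E; case: (ltngtP i j) => ij.
- by apply: (tight_y_mate ij ju); rewrite E K.
- exact: (tight_y_mate ij iu).
- by have := tight_ysupp ju; rewrite -E ij eqxx.
Qed.

(** From [m c], the stem backwards leads to [b], and entering the stem from
    [x i] leads back to [c] without completing the first blossom: this and [z]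
    form a shorter posy with trivial stem. *)
Lemma tight_xy i k : 0 < i -> i < r -> k <= u -> x i <> y k.
Proof.
move=> i0 ir ku E.
have [] := @tight_le s 0 (u + i + (u - k)); last by lia.
exists (z 0), (m (z 0)); split; try by case: t.
- by rewrite K eq_sym; case: t.
- exact: linked_zs.
- exact: linked0.
- rewrite K; apply: (@linked_cat _ _ _ _ _ _ (x i)).
    apply: (@linked_cat _ _ _ _ _ _ (x 0)); last first.
      by apply: eq_linked (linked_x (i := 0) (j := i) _) _ _ _ => //; lia.
    by apply: eq_linked (mirr linked_yu) _ _ _; rewrite ?K.
  by rewrite E -(tight_yu t); apply: linked_y; lia.
Qed.

End Facts.

Section MoreFacts.
Variables (m : V -> V) (r u s : nat) (x y z : nat -> V).
Hypothesis t : tight m r u s x y z.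

Let K : involutive m. Proof. exact: matchingK (tight_m t). Qed.
Let mirr := linked_mirror (tight_m t).

Lemma tight_x_sep i j : 0 < i < r -> j <= r -> x i <> m (x j).
Proof.
move=> /andP[i0 ir] jr E; case: (ltngtP i j) => ij.
- by apply: (tight_x_mate t ij jr); [left|rewrite E K].
- by apply: (tight_x_mate t ij (ltnW ir)); [right|].
- by have := tight_xsupp t jr; rewrite -E ij eqxx.
Qed.

Lemma tight_x_ninj i j : i <= r -> j <= r -> i != j -> x i <> x j.
Proof.
move=> ir jr; case: (ltngtP i j) => // ij _ E.
  exact: (tight_x_inj t ij jr E).
by apply: (tight_x_inj t ij ir).
Qed.

Lemma tight_xy_mate i k : 0 < i -> i < r -> k <= u -> x i <> m (y k).
Proof.
move=> i0 ir ku E; apply: (@tight_xy _ _ _ _ _ _ _ (tight_mirrorx t) (r - i) k) => //; try lia.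
by rewrite /mirror subKn 1?ltnW // E K.
Qed.

End MoreFacts.

Section Crossing.
Variables (m : V -> V) (r u s : nat) (x y z : nat -> V).
Hypothesis t : tight m r u s x y z.

Let K : involutive m. Proof. exact: matchingK (tight_m t). Qed.
Let mirr := linked_mirror (tight_m t).

Lemma tight_zy i k : 0 < i -> i < s -> k <= u -> z i <> y k.
Proof.
move=> i0 ir ku E.
apply: (@tight_xy_mate _ _ _ _ _ _ _ (tight_swap t) i (u - k)) => //; first lia.
by rewrite /mirror K subKn.
Qed.

Lemma tight_zy_mate i k : 0 < i -> i < s -> k <= u -> z i <> m (y k).
Proof.
move=> i0 ir ku E.
apply: (@tight_xy _ _ _ _ _ _ _ (tight_swap t) i (u - k)) => //; first lia.
by rewrite /mirror subKn.
Qed.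

(** Between two common vertices met in the same order, each blossom could use
    the segment of the other one. *)
Lemma tight_diag i j k l : i < j -> j < r -> k < l -> l < s ->
  x i = z k -> x j = z l -> j - i = l - k.
Proof.
move=> ij jr kl ls E1 E2.
have p1 : posy G m (i + ((l - k) + (r - j))) u s.
  exists (x 0), (z 0); split; try by case: t.
  - apply: (@linked_cat _ _ _ _ _ _ (x i)).
      by apply: eq_linked (linked_x t (i := 0) (j := i) _) _ _ _ => //; lia.
    apply: (@linked_cat _ _ _ _ _ _ (x j)).
      by rewrite E1 E2; apply: (linked_z t); lia.
    by rewrite -(tight_xr t); apply: (linked_x t); lia.
  - exact: linked_yu t.
  - exact: linked_zs t.
have p2 : posy G m r u (k + ((j - i) + (s - l))).
  exists (x 0), (z 0); split; try by case: t.
  - exact: linked_xr t.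
  - exact: linked_yu t.
  - apply: (@linked_cat _ _ _ _ _ _ (z k)).
      by apply: eq_linked (linked_z t (i := 0) (j := k) _) _ _ _ => //; lia.
    apply: (@linked_cat _ _ _ _ _ _ (z l)).
      by rewrite -E1 -E2; apply: (linked_x t); lia.
    by rewrite -(tight_zs t); apply: (linked_z t); lia.
have [] := tight_le t p1; have [] := tight_le t p2; lia.
Qed.

(** Following the first blossom from [x i] to [x j] and then the second one
    backwards leads from [x i] to its mate, and the stem leads back: a
    posy with trivial stem that is too short. *)
Lemma tight_nomix_lt i j k l : i < j -> j < r -> k < l -> l < s ->
  x i = z k -> m (x j) = z l -> False.
Proof.
move=> ij jr kl ls E1 E2.
have [] := tight_le t (_ : posy G m ((j - i) + (l - k)) 0 (i + (u + k))); last by lia.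
have si : m (x i) != x i by apply: (tight_xsupp t); lia.
exists (x i), (m (x i)); split=> //.
- by rewrite K eq_sym.
- apply: (@linked_cat _ _ _ _ _ _ (x j)); first by apply: (linked_x t); lia.
  rewrite -{1}(K (x j)) E2 E1; apply: mirr; apply: (linked_z t); lia.
- exact: linked0.
- rewrite K; apply: (@linked_cat _ _ _ _ _ _ (m (x 0))).
    by apply: mirr; apply: eq_linked (linked_x t (i := 0) (j := i) _) _ _ _ => //; lia.
  apply: linked_cat (linked_yu t) _.
  by rewrite E1; apply: eq_linked (linked_z t (i := 0) (j := k) _) _ _ _ => //; lia.
Qed.

End Crossing.

(** Two blossoms cannot share one matching edge traversed in the same direction
    and another one traversed in opposite directions: the reversals of the
    blossoms reduce all the relative positions to a single one. *)
Lemma tight_nomix m r u s x y z i j k l : tight m r u s x y z ->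
  0 < i < r -> 0 < j < r -> 0 < k < s -> 0 < l < s ->
  x i = z k -> m (x j) = z l -> False.
Proof.
move=> t ri rj sk sl E1 E2.
have K := matchingK (tight_m t).
have main x' z' i' j' k' l' : tight m r u s x' y z' -> 0 < i' < r -> 0 < j' < r ->
    0 < k' < s -> 0 < l' < s -> x' i' = z' k' -> m (x' j') = z' l' -> i' < j' -> False.
  move=> t' ri' rj' sk' sl' E1' E2' ij'.
  case: (ltngtP k' l') => kl'.
  - apply: (tight_nomix_lt t' ij' _ kl' _ E1' E2'); lia.
  - (* reversing the first blossom exchanges the two coincidences *)
    apply: (@tight_nomix_lt _ _ _ _ _ _ _ (tight_mirrorx t') (r - j') (r - i') l' k').
    all: rewrite /mirror ?subKn; try lia; rewrite ?K //.
  - move: E1'; rewrite kl' -E2' => E.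
    by apply: (tight_x_sep t' _ _ E); lia.
case: (ltngtP i j) => ij.
- exact: (main x z i j k l).
- apply: (main (mirror m x r) (mirror m z s) (r - i) (r - j) (s - k) (s - l)).
  + exact/tight_mirrorx/tight_mirrorz.
  all: rewrite /mirror ?subKn; try lia.
  + by rewrite E1.
  + by rewrite E2.
- have Ez : z l = m (z k) by rewrite -E1 -E2 ij.
  by apply: (tight_x_sep (tight_swap t) _ _ Ez); lia.
Qed.

End Tight.

(** * Two blossoms cross in a single segment *)

Section Inversion.
Variables (V : finType) (G : sgraph V).
Variables (m : V -> V) (r u s : nat) (x y z : nat -> V).
Hypothesis t : tight G m r u s x y z.
(* By [tight_nomix] and up to a reversal of [x], both blossoms traverse their
   common matching edges in the same direction. *)
Hypothesis par : forall i k, 0 < i < r -> 0 < k < s -> m (x i) <> z k.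

Let K : involutive m. Proof. exact: matchingK (tight_m t). Qed.

Definition common i k := [/\ 0 < i < r, 0 < k < s & x i = z k].

Lemma common_x_unique i i' k : common i k -> common i' k -> i = i'.
Proof.
move=> [ir _ E] [ir' _ E']; apply/eqP/negPn/negP => ne.
by apply: (tight_x_ninj t _ _ ne); rewrite ?E ?E' //; lia.
Qed.

Lemma common_z_unique i k k' : common i k -> common i k' -> k = k'.
Proof.
move=> [_ ks E] [_ ks' E']; apply/eqP/negPn/negP => ne.
by apply: (tight_x_ninj (tight_swap t) _ _ ne); rewrite -?E -?E' //; lia.
Qed.

(** Choose an inverted pair whose positions [l < k] in the second blossom are
    as close as possible.  Going from [x i] to [x j] along the first blossom
    and from [z l] to [z k] along the second one is an alternating even cycle.
    After switching along it, the first blossom can pass from its part before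
    [x i] to its part after [x j] through the segment of the second one, and
    the second blossom can pass from its first contact with [x i .. x j] to its
    last contact through the segment of the first one.  Both segments are now
    traversed backwards, and [r + s] drops by at least two. *)
Lemma no_inversion i j k l : common i k -> common j l -> i < j -> l < k -> False.
Proof.
move=> c1 c2 ij lk.
have [d [{c1 c2 ij lk}i [{}j [{}k [{}l [cik cjl ij lk dE]]]]] dmin] :
    exists2 d, (exists i j k l, [/\ common i k, common j l, i < j, l < k & k - l = d])
      & forall e, (exists i j k l, [/\ common i k, common j l, i < j, l < k & k - l = e])
          -> d <= e.
  by apply: ex_least; exists (k - l), i, j, k, l.
(* Minimality of [k - l] keeps the first blossom away from the inner vertices
   of the segment of the second one. *)
have gap h e : common h e -> l < e < k -> False.
  move=> che /andP[le ek]; case: (ltnP h j) => hj.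
    by have := dmin (e - l) (ex_intro _ h (ex_intro _ j (ex_intro _ e (ex_intro _ l
      (And5 che cjl hj le erefl))))); lia.
  have ih : i < h by lia.
  by have := dmin (k - e) (ex_intro _ i (ex_intro _ h (ex_intro _ k (ex_intro _ e
      (And5 cik che ih ek erefl))))); lia.
(* The first and last contacts of the second blossom with the segment
   [x i .. x j], at positions [k2] and [k1]. *)
have [k2 [i2 i2b c2] k2min] : exists2 k2, (exists2 i2, i <= i2 <= j & common i2 k2)
    & forall k', (exists2 i2, i <= i2 <= j & common i2 k') -> k2 <= k'.
  by apply: ex_least; exists l, j => //; lia.
have [d1 [k1 [i1 [i1b c1 d1E]]] d1min] :
    exists2 d1, (exists k1 i1, [/\ i <= i1 <= j, common i1 k1 & s - k1 = d1])
    & forall d', (exists k1 i1, [/\ i <= i1 <= j, common i1 k1 & s - k1 = d']) -> d1 <= d'.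
  by apply: ex_least; exists (s - k), k, i; split=> //; lia.
have k2l : k2 <= l by apply: k2min; exists j => //; lia.
have k1k : k <= k1.
  have [_ ? _] := c1; have [_ ? _] := cik.
  have : d1 <= s - k by apply: d1min; exists k, i; split=> //; lia.
  lia.
have [ir sk Eik] := cik; have [jr sl Ejl] := cjl.
have [i1r sk1 E1] := c1; have [i2r sk2 E2] := c2.
have i12 : i1 < i2.
  rewrite ltnNge; apply/negP; rewrite leq_eqVlt => /orP[/eqP E|lt].
    by move: c1; rewrite -E => /(common_z_unique c2); lia.
  have D1 : i1 - i2 = k1 - k2 by apply: (tight_diag t lt _ _ _ E2 E1); lia.
  have ii1 : i < i1 by lia.
  have kk1 : k < k1.
    rewrite ltn_neqAle k1k andbT; apply/eqP => E.
    by move: c1; rewrite -E => /(common_x_unique cik); lia.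
  have D2 : i1 - i = k1 - k by apply: (tight_diag t ii1 _ kk1 _ Eik E1); lia.
  lia.
pose A := j - i; pose L := A + (k - l).
(* The alternating cycle, of length [L], starting at [x i = z k]. *)
pose f a := if a <= A then x (i + a) else z (l + (a - A)).
have fx a : a <= A -> f a = x (i + a) by rewrite /f => ->.
have fz a : A <= a -> f a = z (l + (a - A)).
  rewrite leq_eqVlt => /orP[/eqP<-|lt]; last by rewrite /f leqNgt lt.
  rewrite fx // subnn addn0 -Ejl; congr x; lia.
have fL : f L = x i by rewrite fz ?leq_addr // Eik; congr z; lia.
have f0 : f 0 = x i by rewrite fx // addn0.
have fw : walk G m f L.
  move=> a aL; case: (ltnP a A) => aA.
    by rewrite (fx a (ltnW aA)) (fx a.+1 aA) addnS; apply: (tight_x t); lia.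
  rewrite !fz; [|lia..].
  have -> : l + (a.+1 - A) = (l + (a - A)).+1 by lia.
  by apply: (tight_z t); lia.
have L0 : 0 < L by lia.
have xz h e : 0 < h < r -> l < e < k -> x h <> z e.
  by move=> hr ek E; apply: (gap h e) => //; split=> //; lia.
have xmz h e : 0 < h < r -> 0 < e < s -> x h <> m (z e).
  by move=> hr ek E; apply: (par hr ek); rewrite E K.
have finj a b : a < b < L -> f a <> f b.
  move=> /andP[ab bL]; case: (leqP b A) => bA.
    by rewrite !fx; [apply: (tight_x_inj t); lia|lia..].
  rewrite (fz b); last by lia.
  case: (leqP a A) => aA; first by rewrite fx //; apply: xz; lia.
  by rewrite fz; [apply: (tight_x_inj (tight_swap t)); lia|lia].
have fm a b : a < L -> b < L -> f a <> m (f b).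
  move=> aL bL; case: (leqP a A) => aA; case: (leqP b A) => bA.
  - by rewrite !fx //; apply: (tight_x_sep t); lia.
  - by rewrite fx // fz; [apply: xmz; lia|lia].
  - rewrite fz 1?ltnW // fx // => E.
    by apply: (par (_ : 0 < i + b < r)) (esym E); lia.
  - by rewrite !fz 1?ltnW //; apply: (tight_x_sep (tight_swap t)); lia.
have [m' [mm' sm' m'f m'off]] :=
  switch (tight_m t) fw L0 (etrans fL (esym f0)) finj fm.
have m'ne v : (m' v != v) = (m v != v) by have /setP/(_ v) := sm'; rewrite !inE.
pose off v := forall a, a < L -> v <> f a /\ v <> m (f a).
have offI v : (forall h, i <= h <= j -> v <> x h /\ v <> m (x h)) ->
    (forall e, l < e < k -> v <> z e /\ v <> m (z e)) -> off v.
  move=> vx vz a aL; case: (leqP a A) => aA; first by rewrite fx //; apply: vx; lia.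
  by rewrite fz 1?ltnW //; apply: vz; lia.
have keep v w : forces G m v w -> off w -> forces G m' v w.
  by rewrite /forces !m'ne => vw /m'off ->.
have enter v a : a < L -> forces G m v (f a.+1) -> forces G m' v (f a).
  move=> aL /and3P[v0 _ vf]; rewrite /forces !m'ne v0 m'f // vf.
  by rewrite (walk_supp fw) //; lia.
have down a : a < L -> forces G m' (f a.+1) (f a).
  move=> aL; rewrite /forces !m'ne m'f // !(walk_supp fw) //; last by lia.
  case: (tight_m t) => _; apply; apply: (walk_supp fw) => //; lia.
have keepw g n a b : walk G m g n -> a <= b <= n ->
    (forall h, a < h <= b -> off (g h)) -> linked G m' (b - a) (g a) (g b).
  move=> gw abn goff; exists (fun h => g (a + h)); split.
  - move=> h hlt; rewrite addnS; apply: keep; first by apply: gw; lia.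
    by rewrite -addnS; apply: goff; lia.
  - by rewrite addn0.
  - by congr g; lia.
have offx h : 0 <= h < i \/ j < h <= r -> off (x h).
  move=> hb; apply: offI => h' hb'.
    split; last by move/(canLR K)/esym; apply: (tight_x_sep t); lia.
    by apply: (tight_x_ninj t); lia.
  case: (posnP h) => [->|h0].
    rewrite -[x 0]K -(tight_y0 t); split.
      by move/esym; apply: (tight_zy_mate t); lia.
    by move/(can_inj K)/esym; apply: (tight_zy t); lia.
  case: (ltnP h r) => hr.
    by split; [apply: xz|apply: xmz]; lia.
  have -> : h = r by lia.
  rewrite (tight_xr t) -(tight_y0 t); split.
    by move/esym; apply: (tight_zy t); lia.
  by move/(canLR K)/esym; apply: (tight_zy_mate t); lia.
have offz h : 0 <= h < k2 \/ k1 < h <= s -> off (z h).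
  move=> hb; apply: offI => h' hb'; last first.
    split; last by move/(canLR K)/esym; apply: (tight_x_sep (tight_swap t)); lia.
    by apply: (tight_x_ninj (tight_swap t)); lia.
  case: (posnP h) => [->|h0].
    rewrite -(tight_yu t); split.
      by move/esym; apply: (tight_xy t); lia.
    by move/(canLR K)/esym; apply: (tight_xy_mate t); lia.
  case: (ltnP h s) => hs; last first.
    have -> : h = s by lia.
    rewrite (tight_zs t) -(tight_yu t); split.
      by move/esym; apply: (tight_xy_mate t); lia.
    by move/(can_inj K)/esym; apply: (tight_xy t); lia.
  split; last by move/esym; apply: par; lia.
  move=> E; have ch : common h' h by split=> //; lia.
  case: hb => hb.
    have : k2 <= h by apply: k2min; exists h'.
    by lia.
  have : d1 <= s - h by apply: d1min; exists h, h'.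
  by lia.
have offy h : h <= u -> off (y h).
  move=> hu; apply: offI => h' hb'; split.
  - by move/esym; apply: (tight_xy t); lia.
  - by move/(canLR K)/esym; apply: (tight_xy_mate t); lia.
  - by move/esym; apply: (tight_zy t); lia.
  - by move/(canLR K)/esym; apply: (tight_zy_mate t); lia.
have m'x0 : m' (x 0) = m (x 0) by apply/m'off/offx; lia.
have m'z0 : m' (z 0) = m (z 0) by apply/m'off/offz; lia.
(* The vertices of the old posy outside the cycle keep their mates, so its
   walks survive there; inside, they run down the cycle by [down]. *)
have P : posy G m' ((i - 1) + (1 + ((L.-1 - A) + (r - j)))) u
    ((k2 - 1) + (1 + ((i2 - i).-1 - (i1 - i) + (s - k1)))).
  exists (x 0), (z 0); rewrite m'x0 m'z0; split; try by case: t.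
  - apply: (@linked_cat _ _ _ _ _ _ (x (i - 1))).
      apply: eq_linked (keepw x r 0 (i - 1) (tight_x t) _ _) _ _ _ => //; try lia.
      by move=> h hb; apply: offx; lia.
    apply: (@linked_cat _ _ _ _ _ _ (f L.-1)).
      apply: linked_forces; apply: enter; first by lia.
      rewrite prednK // fL; have {2}-> : i = (i - 1).+1 by lia.
      by apply: (tight_x t); lia.
    apply: (@linked_cat _ _ _ _ _ _ (x j)).
      have -> : x j = f A by rewrite fx //; congr x; lia.
      by apply: linked_down; [lia|move=> a ab; apply: down; lia].
    rewrite -(tight_xr t); apply: (keepw x r) => //; [exact: tight_x t|lia|].
    by move=> h hb; apply: offx; lia.
  - apply: eq_linked (keepw y u 0 u (tight_y t) _ _) _ _ _ => //; try lia.
    + by move=> h hb; apply: offy; lia.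
    + exact: tight_y0 t.
    + exact: tight_yu t.
  - apply: (@linked_cat _ _ _ _ _ _ (z (k2 - 1))).
      apply: eq_linked (keepw z s 0 (k2 - 1) (tight_z t) _ _) _ _ _ => //; try lia.
      by move=> h hb; apply: offz; lia.
    apply: (@linked_cat _ _ _ _ _ _ (f (i2 - i).-1)).
      apply: linked_forces; apply: enter; first by lia.
      rewrite prednK; last by lia.
      have -> : f (i2 - i) = z k2 by rewrite fx -?E2; [congr x; lia|lia].
      have {2}-> : k2 = (k2 - 1).+1 by lia.
      by apply: (tight_z t); lia.
    apply: (@linked_cat _ _ _ _ _ _ (z k1)).
      have -> : z k1 = f (i1 - i) by rewrite fx -?E1; [congr x; lia|lia].
      by apply: linked_down; [lia|move=> a ab; apply: down; lia].
    rewrite -(tight_zs t); apply: (keepw z s) => //; [exact: tight_z t|lia|].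
    by move=> h hb; apply: offz; lia.
have [le _] := tight_min t mm' sm' P.
lia.
Qed.

End Inversion.

(** * Reading off the subdivision *)

Section Threads.
Variables (V : finType) (G : sgraph V).
Implicit Types (m : V -> V) (f : nat -> V) (a : pred V).

(** The vertices of the alternating path traced by a walk [f], grouped by
    matching edges: [m (f i), f i, m (f i.+1), ..., f j.-1]. *)
Definition thread m f i j := flatten [seq [:: m (f k); f k] | k <- index_iota i j].

(** The same grouped by nonmatching edges, for paths starting and ending with
    a matching edge: [f i, m (f i.+1), f i.+1, ..., m (f j)]. *)
Definition mthread m f i j := flatten [seq [:: f k; m (f k.+1)] | k <- index_iota i j].

Lemma count_thread a m f i j : count a (thread m f i j) =
  \sum_(i <= k < j) (a (f k) : nat) + \sum_(i <= k < j) (a (m (f k)) : nat).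
Proof.
rewrite count_flatten sumnE !big_map -big_split.
by apply: eq_bigr => k _ /=; lia.
Qed.

Lemma count_mthread a m f i j : count a (mthread m f i j) =
  \sum_(i <= k < j) (a (f k) : nat) + \sum_(i <= k < j) (a (m (f k.+1)) : nat).
Proof.
rewrite count_flatten sumnE !big_map -big_split.
by apply: eq_bigr => k _ /=; lia.
Qed.

Lemma even_thread m f i j : ~~ odd (size (thread m f i j)).
Proof. by rewrite -count_predT count_thread addnn odd_double. Qed.

Lemma even_mthread m f i j : ~~ odd (size (mthread m f i j)).
Proof. by rewrite -count_predT count_mthread addnn odd_double. Qed.

Lemma index_iotaSr i j : i <= j -> index_iota i j.+1 = rcons (index_iota i j) j.
Proof.
by move=> le; rewrite /index_iota subSn // -addn1 iotaD /= subnKC // cats1.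
Qed.

Lemma thread_path m f n i j : is_matching G m -> walk G m f n -> i < j <= n ->
  path G (f i) (rcons (thread m f i.+1 j) (m (f j))).
Proof.
move=> mm fw; elim: j => // j IH /andP[ij jn].
have step h : h < n -> G (f h) (m (f h.+1)) by move=> /fw/and3P[].
move: ij; rewrite ltnS leq_eqVlt => /orP[/eqP E|ij].
  by rewrite /thread /index_iota E subnn /= andbT; apply: step.
rewrite /thread index_iotaSr // map_rcons flatten_rcons -cats1 -catA /=.
rewrite -cat_rcons cat_path last_rcons IH ?ij 1?ltnW //= step // !andbT adj_sym.
by case: mm => _; apply; apply: (walk_supp fw); lia.
Qed.

Lemma mthread_path m f n i j : is_matching G m -> walk G m f n -> i <= j <= n ->
  (forall k, k <= n -> m (f k) != f k) ->
  path G (m (f i)) (rcons (mthread m f i j) (f j)).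
Proof.
move=> mm fw; have step h : h < n -> G (f h) (m (f h.+1)) by move=> /fw/and3P[].
have mate v : m v != v -> G (m v) v by rewrite adj_sym; case: mm => _; apply.
elim: j => [|j IH] ijn fs.
  have -> : i = 0 by lia.
  by rewrite /mthread /index_iota /= andbT; apply: mate; apply: fs.
case: (ltngtP i j.+1) => [ij||->]; last 2 first; try by lia.
  by rewrite /mthread /index_iota subnn /= andbT; apply: mate; apply: fs; lia.
rewrite /mthread index_iotaSr // map_rcons flatten_rcons -cats1 -catA /=.
rewrite -cat_rcons cat_path last_rcons IH //=; last by lia.
by rewrite step ?mate ?fs //; lia.
Qed.

Lemma rev_mthread_path m f n i j : is_matching G m -> walk G m f n -> i <= j <= n ->
  (forall k, k <= n -> m (f k) != f k) ->
  path G (f j) (rcons (rev (mthread m f i j)) (m (f i))).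
Proof.
move=> mm fw ij fs; have := mthread_path mm fw ij fs.
set s := mthread m f i j.
have -> : rcons (rev s) (m (f i)) = rev (belast (m (f i)) (rcons s (f j))).
  by rewrite belast_rcons rev_cons.
rewrite -{2}[f j](last_rcons (m (f i)) s) rev_path.
by apply: sub_path => v w; rewrite adj_sym.
Qed.

Definition restr m (S : {set V}) v := if v \in S then m v else v.

(** A walk inside [S] only uses the part of the matching inside [S]. *)
Lemma linked_restr m (S : {set V}) f n i j : walk G m f n -> i <= j <= n ->
  (forall k, i <= k <= j -> f k \in S) -> linked G (restr m S) (j - i) (f i) (f j).
Proof.
move=> fw ij fS; exists (fun k => f (i + k)); split.
- move=> k kn; have ik : i + k < n by lia.
  have S1 : f (i + k) \in S by apply: fS; lia.
  have S2 : f (i + k).+1 \in S by apply: fS; lia.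
  by rewrite addnS /forces /restr S1 S2; apply: fw.
- by rewrite addn0.
- by congr f; lia.
Qed.

End Threads.

Section Spanning.
Variables (V : finType) (G : sgraph V).
Variables (m : V -> V) (r u s : nat) (x y z : nat -> V).
Hypothesis t : tight G m r u s x y z.
Hypothesis least : forall S : {set V}, S \subset supp m ->
  (forall v, v \in S -> m v \in S) ->
  (exists r' u' s', posy G (restr m S) r' u' s') -> S = supp m.

Let K : involutive m. Proof. exact: matchingK (tight_m t). Qed.

(* One vertex of every matching edge of the configuration is listed in [reps].
   The positions [p <= k < q] of the second blossom are left out: there it runs
   between the first and the last common edge, or the range is empty. *)
Section Representatives.
Variables p q : nat.
Hypothesis pq : 0 < p <= q.
Hypothesis sep : forall i k, 0 < i < r -> 0 < k < s -> (k < p) || (q <= k) ->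
  x i <> z k /\ x i <> m (z k).

Definition reps := [seq x k | k <- index_iota 1 r] ++ [seq y k | k <- index_iota 0 u.+1]
  ++ [seq z k | k <- index_iota 1 (minn p s)] ++ [seq z k | k <- index_iota q s].

Lemma repsP v : v \in reps ->
  [\/ exists2 i, 0 < i < r & v = x i, exists2 i, i <= u & v = y i
    | exists2 k, 0 < k < s & (k < p) || (q <= k) /\ v = z k].
Proof.
rewrite !mem_cat => /or4P[] /mapP[i]; rewrite mem_index_iota => ib ->.
- by apply: Or31; exists i.
- by apply: Or32; exists i.
- by apply: Or33; exists i; [lia|split=> //; lia].
- by apply: Or33; exists i; [lia|split=> //; lia].
Qed.

Definition body := reps ++ map m reps.

Lemma reps_nmate v w : v \in reps -> w \in reps -> v <> m w.
Proof.
move=> /repsP[[i ib ->]|[i ib ->]|[i ib [ib' ->]]] /repsP[[j jb ->]|[j jb ->]|[j jb [jb' ->]]] E.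
- by apply: (tight_x_sep t _ _ E); lia.
- by apply: (tight_xy_mate t _ _ _ E); lia.
- by case: (sep ib jb jb') => _; apply.
- by apply: (tight_xy_mate t _ _ _ (esym (canLR K E))); lia.
- by apply: (tight_y_sep t _ _ E); lia.
- by apply: (tight_zy_mate t _ _ _ (esym (canLR K E))); lia.
- by case: (sep jb ib ib') => _; apply; rewrite E K.
- by apply: (tight_zy_mate t _ _ _ E); lia.
- by apply: (tight_x_sep (tight_swap t) _ _ E); lia.
Qed.

Lemma uniq_range (f : nat -> V) n i j :
  (forall a b, a < b -> b <= n -> f a <> f b) -> j <= n.+1 ->
  uniq [seq f k | k <- index_iota i j].
Proof.
move=> finj jn; rewrite map_inj_in_uniq ?iota_uniq // => a b.
rewrite !mem_index_iota => ab bb E; case: (ltngtP a b) => // lt.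
- by case: (finj a b) => //; lia.
- by case: (finj b a) => //; lia.
Qed.

Lemma uniq_body : uniq body.
Proof.
have ur : uniq reps.
  have zu i j : j <= s.+1 -> uniq [seq z k | k <- index_iota i j].
    by apply: uniq_range; apply: (tight_x_inj (tight_swap t)).
  rewrite !cat_uniq !zu 1?(@uniq_range _ r) 1?(@uniq_range _ u) ?andbT ?andTb //; try lia.
  - apply/and3P; split.
    + apply/hasPn => v; rewrite !mem_cat => /or3P[] /mapP[k];
        rewrite mem_index_iota => kb ->; apply/mapP => -[i]; rewrite mem_index_iota => ib E.
      * by apply: (tight_xy t _ _ _ (esym E)); lia.
      * by case: (@sep i k) => //; try lia; rewrite E.
      * by case: (@sep i k) => //; try lia; rewrite E.
    + apply/hasPn => v; rewrite !mem_cat => /orP[] /mapP[k];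
        rewrite mem_index_iota => kb ->; apply/mapP => -[i]; rewrite mem_index_iota => ib E.
      * by apply: (tight_zy t _ _ _ E); lia.
      * by apply: (tight_zy t _ _ _ E); lia.
    + apply/hasPn => v /mapP[k]; rewrite mem_index_iota => kb ->.
      apply/mapP => -[i]; rewrite mem_index_iota => ib E.
      by apply: (tight_x_inj (tight_swap t) _ _ (esym E)); lia.
  - exact: tight_y_inj t.
  - exact: tight_x_inj t.
rewrite cat_uniq map_inj_uniq ?ur ?andbT; last exact: can_inj K.
apply/hasPn => v /mapP[w wr ->]; apply/negP => mr.
exact: (reps_nmate mr wr).
Qed.

Lemma count_body a : count a body =
  (\sum_(1 <= k < r) (a (x k) : nat) + \sum_(0 <= k < u.+1) (a (y k) : nat) +
   \sum_(1 <= k < minn p s) (a (z k) : nat) + \sum_(q <= k < s) (a (z k) : nat)) +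
  (\sum_(1 <= k < r) (a (m (x k)) : nat) + \sum_(0 <= k < u.+1) (a (m (y k)) : nat) +
   \sum_(1 <= k < minn p s) (a (m (z k)) : nat) + \sum_(q <= k < s) (a (m (z k)) : nat)).
Proof.
have cm (f : nat -> V) i j : count a [seq f k | k <- index_iota i j] =
    \sum_(i <= k < j) (a (f k) : nat).
  by rewrite -sumn_count -map_comp sumnE !big_map.
by rewrite /body /reps !map_cat -!map_comp !count_cat !cm; lia.
Qed.

Lemma body_mate v : v \in body -> m v \in body.
Proof.
rewrite mem_cat [m v \in body]mem_cat => /orP[vr|/mapP[w wr ->]].
  by rewrite map_f ?orbT.
by rewrite K wr.
Qed.

Lemma body_y i : i <= u -> y i \in body.
Proof.
move=> iu; rewrite !mem_cat.
suff -> : y i \in [seq y k | k <- index_iota 0 u.+1] by rewrite !orbT.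
by apply: map_f; rewrite mem_index_iota.
Qed.

Lemma body_x i : i <= r -> x i \in body.
Proof.
move=> ir; have x0 : m (x 0) \in body by rewrite -(tight_y0 t) body_y.
case: (posnP i) => [->|i0]; first by rewrite -[x 0]K body_mate.
case: (ltnP i r) => ir'; last by have -> : i = r by [lia]; rewrite (tight_xr t).
rewrite !mem_cat; suff -> : x i \in [seq x k | k <- index_iota 1 r] by [].
by apply: map_f; rewrite mem_index_iota; lia.
Qed.

Lemma body_z k : k <= s -> (k < p) || (q <= k) -> z k \in body.
Proof.
move=> ks kb; have z0 : z 0 \in body by rewrite -(tight_yu t) body_y.
case: (posnP k) => [->//|k0].
case: (ltnP k s) => ks'; last first.
  by have -> : k = s by [lia]; rewrite (tight_zs t) body_mate.
rewrite !mem_cat; case/orP: kb => kb.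
  suff -> : z k \in [seq z k | k <- index_iota 1 (minn p s)] by rewrite !orbT.
  by apply: map_f; rewrite mem_index_iota; lia.
suff -> : z k \in [seq z k | k <- index_iota q s] by rewrite !orbT.
by apply: map_f; rewrite mem_index_iota; lia.
Qed.

Lemma body_supp : {subset body <= supp m}.
Proof.
have rs v : v \in reps -> m v != v.
  move=> /repsP[[i ib ->]|[i ib ->]|[i ib [ib' ->]]].
  - by apply: (tight_xsupp t); lia.
  - exact: (tight_ysupp t).
  - by apply: (tight_xsupp (tight_swap t)); lia.
move=> v; rewrite mem_cat inE => /orP[/rs//|/mapP[w /rs wr ->]].
by rewrite K eq_sym.
Qed.

(** The matching restricted to [body] still has a posy, so leastness of the
    support leaves no other vertex. *)
Lemma body_spans : (exists n, linked G (restr m [set v in body]) n (z 0) (m (z 0))) ->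
  forall v, (v \in body) = (v \in supp m).
Proof.
move=> [n zl] v; rewrite -(@least [set v in body]); first by rewrite inE.
- by apply/subsetP => w; rewrite inE; apply: body_supp.
- by move=> w; rewrite !inE; apply: body_mate.
have rE w : w \in body -> restr m [set v in body] w = m w.
  by rewrite /restr inE => ->.
have x0 := body_x (leq0n r); have z0 : z 0 \in body by rewrite -(tight_yu t) body_y.
exists (r - 0), (u - 0), n, (x 0), (z 0); rewrite !rE //; split; try by case: t.
- rewrite -(tight_xr t); apply: (linked_restr (tight_x t)); first lia.
  by move=> k kr; rewrite inE body_x //; lia.
- rewrite -(tight_yu t) -(tight_y0 t); apply: (linked_restr (tight_y t)); first lia.
  by move=> k kr; rewrite inE body_y //; lia.
Qed.

End Representatives.

(** The branch vertices on each blossom are its tip and the two ends of a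
    matching edge next to the tip. *)
Lemma disjoint_blossoms_T :
    (forall i k, 0 < i < r -> 0 < k < s -> x i <> z k /\ x i <> m (z k)) ->
  has_spanning_even_subdivision T (induced G (supp m)).
Proof.
move=> sep; have r1 := tight_r t; have s1 := tight_r (tight_swap t).
have sep' i k : 0 < i < r -> 0 < k < s -> (k < s) || (s <= k) -> x i <> z k /\ x i <> m (z k).
  by move=> *; apply: sep.
have ss : 0 < s <= s by lia.
have spans v : (v \in body s s) = (v \in supp m).
  apply: (body_spans ss); exists (s - 0).
  rewrite -(tight_zs t); apply: (linked_restr (tight_z t)); first lia.
  by move=> k ks; rewrite inE body_z //; lia.
pose P e := match e with
  | (1, 2) => thread m x 2 r | (2, 3) => mthread m y 0 u
  | (3, 4) => thread m z 1 s.-1 | _ => [::] end.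
pose es := [:: (0, 1); (0, 2); (1, 2); (2, 3); (3, 4); (3, 5); (4, 5)].
pose vs := [:: m (x 1); x 1; x 0; z 0; m (z s.-1); z s.-1].
have perm_body : perm_eq (vs ++ flatten [seq P e | e <- es]) (body s s).
  apply/permP => a; rewrite (count_body ss) /= cats0 !count_cat !count_thread count_mthread.
  rewrite minnn [\sum_(s <= k < s) _]big_geq // [\sum_(s <= k < s) _]big_geq //.
  rewrite ![\sum_(1 <= k < r) _](big_ltn r1).
  rewrite [\sum_(0 <= k < u.+1) a (y k)]big_nat_recr //=.
  rewrite [\sum_(0 <= k < u.+1) a (m (y k))]big_nat_recl //=.
  have -> : \sum_(1 <= k < s) a (z k) = \sum_(1 <= k < s.-1) a (z k) + a (z s.-1).
    by rewrite -big_nat_recr //=; [rewrite prednK //; lia|lia].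
  have -> : \sum_(1 <= k < s) a (m (z k)) = \sum_(1 <= k < s.-1) a (m (z k)) + a (m (z s.-1)).
    by rewrite -big_nat_recr //=; [rewrite prednK //; lia|lia].
  by rewrite (tight_yu t) (tight_y0 t) K; lia.
apply: (@induced_even_subdivisionI _ _ _ _ _ es (x 0) vs P).
- by rewrite inE (tight_xsupp t).
- by move=> e; rewrite !inE => /or4P[|||/or4P[]] /eqP->.
- by move=> [[|[|[|[|[|[|]]]]]] // ?] [[|[|[|[|[|[|]]]]]] // ?].
- by [].
- by rewrite (perm_uniq perm_body) uniq_body.
- by move=> w; rewrite (perm_mem perm_body).
- move=> e; rewrite !inE => /or4P[|||/or4P[]] /eqP-> //=;
    first [exact: even_thread | exact: even_mthread].
- have mm := tight_m t.
  have xst i : i < r -> G (x i) (m (x i.+1)) by move=> /(tight_x t)/and3P[].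
  have zst i : i < s -> G (z i) (m (z i.+1)) by move=> /(tight_z t)/and3P[].
  have mate v : m v != v -> G (m v) v by rewrite adj_sym; case: mm => _; apply.
  move=> e; rewrite !inE => /or4P[|||/or4P[]] /eqP-> /=; rewrite ?andbT.
  + by apply: mate; apply: (tight_xsupp t); lia.
  + by rewrite adj_sym; apply: xst; lia.
  + by rewrite -[x 0]K -(tight_xr t); apply: (thread_path mm (tight_x t)); lia.
  + rewrite -[x 0]K -(tight_y0 t) -(tight_yu t).
    by apply: (mthread_path mm (tight_y t)); [lia|exact: tight_ysupp t].
  + by apply: (thread_path mm (tight_z t)); lia.
  + rewrite adj_sym -[z 0]K -(tight_zs t); have {2}-> : s = s.-1.+1 by lia.
    by apply: zst; lia.
  + by apply: mate; apply: (tight_xsupp (tight_swap t)); lia.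
Qed.

(** The branch vertices are the two tips and the two ends of the common
    segment.  Every path of the subdivision has both its end edges outside the
    matching, or both in it, and so is odd. *)
Lemma shared_segment_K4 f l p q :
    0 < f <= l -> l < r -> 0 < p <= q -> q < s -> x f = z p -> x l = z q ->
    (forall i k, 0 < i < r -> 0 < k < s -> (k < p) || (q < k) ->
       x i <> z k /\ x i <> m (z k)) ->
  has_spanning_even_subdivision K4 (induced G (supp m)).
Proof.
move=> fl lr pq qs Ef El sep; have r1 := tight_r t; have s1 := tight_r (tight_swap t).
have pq' : 0 < p <= q.+1 by lia.
have spans v : (v \in body p q.+1) = (v \in supp m).
  apply: (body_spans pq'); exists ((p - 0) + ((l - f) + (s - q))).
  have xS i : f <= i <= l -> x i \in [set v in body p q.+1].
    by move=> ib; rewrite inE; apply: body_x; lia.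
  apply: (@linked_cat _ _ _ _ _ _ (z p)).
    apply: (linked_restr (tight_z t)); first lia.
    move=> k kp; case: (ltnP k p) => kp'; first by rewrite inE body_z //; lia.
    by have -> : k = p by [lia]; rewrite -Ef xS //; lia.
  rewrite -Ef; apply: (@linked_cat _ _ _ _ _ _ (x l)).
    by apply: (linked_restr (tight_x t)); [lia|exact: xS].
  rewrite El -(tight_zs t); apply: (linked_restr (tight_z t)); first lia.
  move=> k kp; case: (ltnP q k) => kp'; first by rewrite inE body_z //; lia.
  by have -> : k = q by [lia]; rewrite -El xS //; lia.
pose P e := match e with
  | (0, 1) => thread m x l.+1 r | (0, 2) => thread m z q.+1 s
  | (0, 3) => rev (mthread m x f l) | (1, 2) => mthread m y 0 u
  | (1, 3) => thread m x 1 f | (2, 3) => thread m z 1 p | _ => [::] end.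
pose es := [:: (0, 1); (0, 2); (0, 3); (1, 2); (1, 3); (2, 3)].
pose vs := [:: x l; x 0; z 0; m (x f)].
have perm_body : perm_eq (vs ++ flatten [seq P e | e <- es]) (body p q.+1).
  apply/permP => a; rewrite (count_body pq') /= cats0 !count_cat count_rev.
  rewrite !count_thread !count_mthread.
  rewrite (minn_idPl _); last by lia.
  rewrite [\sum_(0 <= k < u.+1) a (y k)]big_nat_recr //=.
  rewrite [\sum_(0 <= k < u.+1) a (m (y k))]big_nat_recl //=.
  have cut (g : nat -> nat) : \sum_(1 <= k < r) g k =
      \sum_(1 <= k < f) g k + (\sum_(f <= k < l) g k + g l) + \sum_(l.+1 <= k < r) g k.
    by rewrite -big_nat_recr -?big_cat_nat //=; lia.
  have cut' (g : nat -> nat) : \sum_(1 <= k < r) g k =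
      \sum_(1 <= k < f) g k + (g f + \sum_(f <= k < l) g k.+1) + \sum_(l.+1 <= k < r) g k.
    by rewrite -big_nat_recl -?big_cat_nat //=; lia.
  rewrite (cut (fun k => a (x k) : nat)) (cut' (fun k => a (m (x k)) : nat)).
  by rewrite (tight_yu t) (tight_y0 t) K; lia.
apply: (@induced_even_subdivisionI _ _ _ _ _ es (x 0) vs P).
- by rewrite inE (tight_xsupp t).
- by move=> e; rewrite !inE => /or4P[|||/or3P[]] /eqP->.
- by move=> [[|[|[|[|]]]] // ?] [[|[|[|[|]]]] // ?].
- by [].
- by rewrite (perm_uniq perm_body) uniq_body.
- by move=> w; rewrite (perm_mem perm_body).
- move=> e; rewrite !inE => /or4P[|||/or3P[]] /eqP-> //=; rewrite ?size_rev;
    first [exact: even_thread | exact: even_mthread].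
- have mm := tight_m t.
  move=> e; rewrite !inE => /or4P[|||/or3P[]] /eqP-> /=.
  + by rewrite -[x 0]K -(tight_xr t); apply: (thread_path mm (tight_x t)); lia.
  + by rewrite El -[z 0]K -(tight_zs t); apply: (thread_path mm (tight_z t)); lia.
  + by apply: (rev_mthread_path mm (tight_x t)); [lia|exact: tight_xsupp t].
  + rewrite -[x 0]K -(tight_y0 t) -(tight_yu t).
    by apply: (mthread_path mm (tight_y t)); [lia|exact: tight_ysupp t].
  + by apply: (thread_path mm (tight_x t)); lia.
  + by rewrite Ef; apply: (thread_path mm (tight_z t)); lia.
Qed.

End Spanning.

(** * Deming parts and the decomposition *)

Section TightSubdivision.
Variables (V : finType) (G : sgraph V).
Variables (m : V -> V) (r u s : nat) (x y z : nat -> V).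
Hypothesis t : tight G m r u s x y z.
Hypothesis least : forall S : {set V}, S \subset supp m ->
  (forall v, v \in S -> m v \in S) ->
  (exists r' u' s', posy G (restr m S) r' u' s') -> S = supp m.

Let K : involutive m. Proof. exact: matchingK (tight_m t). Qed.

(** By [no_inversion] the common vertices are met in the same order by both
    blossoms, so beyond the first and the last one there are none. *)
Lemma crossing_blossoms_K4 i k : 0 < i < r -> 0 < k < s -> x i = z k ->
  has_spanning_even_subdivision K4 (induced G (supp m)).
Proof.
move=> ir ks Eik.
have par i' k' : 0 < i' < r -> 0 < k' < s -> m (x i') <> z k'.
  by move=> ir' ks' E; apply: (tight_nomix t ir ir' ks ks' Eik E).
have cik : common r s x z i k by split.
have [f [p cfp] fmin] : exists2 f, (exists p, common r s x z f p) &
    forall i', (exists k', common r s x z i' k') -> f <= i'.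
  by apply: ex_least; exists i, k.
have [d [l [q [clq dE]]] dmin] :
    exists2 d, (exists l q, common r s x z l q /\ r - l = d) &
    forall d', (exists l q, common r s x z l q /\ r - l = d') -> d <= d'.
  by apply: ex_least; exists (r - i), i, k.
have first i' k' : common r s x z i' k' -> f <= i' by move=> c; apply: fmin; exists k'.
have last i' k' : common r s x z i' k' -> i' <= l.
  move=> c; have := dmin (r - i') (ex_intro _ i' (ex_intro _ k' (conj c erefl))).
  by case: c; case: clq; lia.
have monotone i1 k1 i2 k2 : common r s x z i1 k1 -> common r s x z i2 k2 ->
    i1 <= i2 -> k1 <= k2.
  move=> c1 c2; rewrite leq_eqVlt => /orP[/eqP E|lt].
    by move: c2; rewrite -E => /(common_z_unique t c1) ->.
  by rewrite leqNgt; apply/negP => /(no_inversion t par c1 c2 lt).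
have fl := first _ _ clq; have pq := monotone _ _ _ _ cfp clq fl.
have [fr ps Ef] := cfp; have [lr qs El] := clq.
apply: (shared_segment_K4 t least (f := f) (l := l) (p := p) (q := q)) => //; try lia.
move=> i' k' ir' ks' kb; split=> E; last by apply: (par i' k' ir' ks'); rewrite E K.
have c : common r s x z i' k' by split.
have := monotone _ _ _ _ cfp c (first _ _ c).
have := monotone _ _ _ _ c clq (last _ _ c).
lia.
Qed.

End TightSubdivision.

(** Common matching edges traversed in opposite directions are traversed in
    the same direction once the first blossom is reversed. *)
Lemma tight_subdivision (V : finType) (G : sgraph V) m r u s x y z :
    tight G m r u s x y z ->
    (forall S : {set V}, S \subset supp m -> (forall v, v \in S -> m v \in S) ->
      (exists r' u' s', posy G (restr m S) r' u' s') -> S = supp m) ->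
  has_spanning_even_subdivision T (induced G (supp m)) \/
  has_spanning_even_subdivision K4 (induced G (supp m)).
Proof.
move=> t least.
case: (classic (exists i k, [/\ 0 < i < r, 0 < k < s & x i = z k \/ x i = m (z k)])).
  move=> [i [k [ir ks [E|E]]]]; right.
    exact: (crossing_blossoms_K4 t least ir ks).
  apply: (crossing_blossoms_K4 (tight_mirrorx t) least (i := r - i) _ ks); first lia.
  rewrite /mirror subKn; last by lia.
  by rewrite E (matchingK (tight_m t)).
move=> no; left; apply: (disjoint_blossoms_T t least) => i k ir ks.
by split=> E; apply: no; exists i, k; split=> //; [left|right].
Qed.

Section Decomposition.
Variables (V : finType) (G : sgraph V).
Implicit Types (S X Y Z : {set V}) (m : V -> V).

Definition matchable X := exists2 m, is_matching G m & supp m = X.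

Lemma restr_matching m S : is_matching G m -> (forall v, v \in S -> m v \in S) ->
  is_matching G (restr m S) /\ supp (restr m S) = S :&: supp m.
Proof.
move=> [K adjm] clS; split; last first.
  by apply/setP => v; rewrite !inE /restr; case: ifP => //; rewrite eqxx.
split=> v; rewrite /restr; last by case: ifP => [_ /adjm//|]; rewrite eqxx.
by case: (boolP (v \in S)) => vS; [rewrite clS ?K|rewrite (negbTE vS)].
Qed.

Lemma matchableU X Y : [disjoint X & Y] -> matchable X -> matchable Y ->
  matchable (X :|: Y).
Proof.
move=> XY [m1 [K1 a1] s1] [m2 [K2 a2] s2].
have in1 v : (m1 v != v) = (v \in X) by rewrite -s1 inE.
have in2 v : (m2 v != v) = (v \in Y) by rewrite -s2 inE.
have off v : v \in X -> v \notin Y by move=> vX; rewrite (disjointFr XY vX).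
have st1 v : (m1 v \in X) = (v \in X) by rewrite -!in1 K1 eq_sym.
have st2 v : v \notin X -> m2 v \notin X.
  move=> vX; case: (boolP (v \in Y)) => vY.
    apply/negP => /off; rewrite -in2 K2 eq_sym in2 vY //.
  by move: vY; rewrite -in2 negbK => /eqP->.
exists (fun v => if v \in X then m1 v else m2 v).
- split=> v; case: (boolP (v \in X)) => vX.
  + by rewrite st1 vX K1.
  + by rewrite (negbTE (st2 _ vX)) K2.
  + exact: a1.
  + exact: a2.
- apply/setP => v; rewrite !inE; case: (boolP (v \in X)) => vX.
    by rewrite in1.
  by rewrite in2.
Qed.

Lemma matchable_setD X Y Z : X \subset Y -> Y \subset Z ->
  matchable (Z :\: Y) -> matchable (Y :\: X) -> matchable (Z :\: X).
Proof.
move=> XY YZ mZ mY.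
have -> : Z :\: X = (Z :\: Y) :|: (Y :\: X).
  apply/setP => v; rewrite in_setU !in_setD.
  have := subsetP XY v; have := subsetP YZ v.
  case: (v \in X) => [_ /(_ isT) ->|YZv _] //=.
  by case: (v \in Y) YZv => [/(_ isT) ->|_] //=; rewrite orbF.
apply: matchableU => //; rewrite -setI_eq0; apply/eqP/setP => v.
by rewrite in_setI !in_setD in_set0; case: (v \in Y); rewrite ?andbF.
Qed.

(** The candidates for a Deming part [supp m] of S0.  Their complement must be
    matchable for the decomposition to go on. *)
Definition spans_posy S0 m := [/\ is_matching G m, supp m \subset S0,
  matchable (S0 :\: supp m) & exists r u s, posy G m r u s].

Lemma least_posy S0 : (exists m, spans_posy S0 m) -> exists m r u s x y z,
  [/\ spans_posy S0 m, tight G m r u s x y z &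
      forall m', spans_posy S0 m' -> #|supp m| <= #|supp m'|].
Proof.
move=> ex.
have [n [m0 sp0 n0] nmin] : exists2 n, (exists2 m, spans_posy S0 m & #|supp m| = n) &
    forall k, (exists2 m, spans_posy S0 m & #|supp m| = k) -> n <= k.
  by apply: ex_least; case: ex => m ?; exists #|supp m|, m.
pose Q N k := exists m r u s, [/\ is_matching G m, supp m = supp m0,
  posy G m r u s, r + u.*2 + s = N & r + s = k].
have [N [k0 QNk0] Nmin] : exists2 N, (exists k, Q N k) & forall N', (exists k, Q N' k) -> N <= N'.
  apply: ex_least; case: sp0 => mm _ _ [r [u [s P]]].
  by exists (r + u.*2 + s), (r + s), m0, r, u, s.
have [k [m [r [u [s [mm sm P EN Ek]]]]] kmin] : exists2 k, Q N k & forall k', Q N k' -> k <= k'.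
  by apply: ex_least; exists k0.
have [b [c [bm cm [x [xw x0 xr]] [y [yw y0 yu]] [z [zw z0 zs]]]]] := P.
exists m, r, u, s, x, y, z; split.
- by case: sp0 => _ ? ? _; split; rewrite ?sm //; exists r, u, s.
- split=> //; try by rewrite ?x0 ?z0.
  move=> m' r' u' s' mm' sm' P'; split.
    by rewrite EN; apply: Nmin; exists (r' + s'), m', r', u', s'; rewrite sm' sm.
  by rewrite EN Ek => E; apply: kmin; exists m', r', u', s'; rewrite sm' sm.
- by move=> m' sp'; rewrite sm n0; apply: nmin; exists m'.
Qed.

Lemma least_posy_restr S0 m : spans_posy S0 m ->
    (forall m', spans_posy S0 m' -> #|supp m| <= #|supp m'|) ->
  forall S, S \subset supp m -> (forall v, v \in S -> m v \in S) ->
    (exists r u s, posy G (restr m S) r u s) -> S = supp m.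
Proof.
move=> [mm sub rest _] mmin S Sm clS P; have [K _] := mm.
have [rm] := restr_matching mm clS; rewrite (setIidPl Sm) => rs.
apply/eqP; rewrite eqEcard Sm -{1}rs mmin //; split; rewrite ?rs //.
  exact: subset_trans sub.
apply: (matchable_setD Sm sub rest).
have cl' v : v \in supp m :\: S -> m v \in supp m :\: S.
  rewrite in_setD [m v \in _]in_setD !inE K eq_sym => /andP[vS ->]; rewrite andbT.
  by apply/negP => /clS; rewrite K (negbTE vS).
have [rm' rs'] := restr_matching mm cl'.
by exists (restr m (supp m :\: S)) => //; rewrite rs' (setIidPl (subsetDl _ _)).
Qed.

(** If a matched edge could be deleted without making the graph KE, the rest
    would carry a posy and the deleted edge could join the matched
    complement, contradicting leastness. *)
Lemma least_posy_deletion S0 m : spans_posy S0 m ->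
    (forall m', spans_posy S0 m' -> #|supp m| <= #|supp m'|) ->
  KE_after_matched_deletion (induced G (supp m)).
Proof.
move=> [mm sub rest _] mmin x y xy [M [pM xyM]].
have [mu [K adjmu] mate] := perfect_matching_mating pM.
have nxy : x != y by apply/eqP => E; rewrite E adj_irr in xy.
have mux : mu x = y by apply: mate.
have muy : mu y = x by rewrite -mux K.
have stay (w : {w | w \in ~: [set x; y]}) : mu (val w) \in ~: [set x; y].
  case: w => w /=; rewrite !inE !negb_or => /andP[wx wy]; apply/andP; split.
    by apply: contraNneq wy => E; rewrite -(K w) E mux.
  by apply: contraNneq wx => E; rewrite -(K w) E muy.
pose mu' (w : {w | w \in ~: [set x; y]}) : {w | w \in ~: [set x; y]} :=
  exist _ (mu (val w)) (stay w).
pose f (w : {w | w \in ~: [set x; y]}) : V := val (val w).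
have mm' : mating (delete (induced G (supp m)) [set x; y]) mu'.
  by split=> w; [apply: val_inj; rewrite /= K|apply: adjmu].
case: (@KE_or_posy _ _ G _ f _ _ _ mm') => //.
- by move=> v w /val_inj/val_inj.
- move=> [m1 [mm1 sm1 P1]].
have sm1E : supp m1 = supp m :\: [set val x; val y].
  rewrite sm1; apply/setP => v; rewrite in_setD in_set2; apply/imsetP/andP.
    move=> [w _ ->]; split; last exact: (valP (val w)).
    by have := valP w; rewrite !inE -!val_eqE.
  move=> [nv vm]; have vm' : v \in supp m by [].
  have wP : exist _ v vm' \in ~: [set x; y] by rewrite !inE -!val_eqE.
  by exists (exist _ (exist _ v vm') wP).
have lt : #|supp m1| < #|supp m|.
  apply: proper_card; rewrite sm1E properE subsetDl /=.
  by apply/subsetPn; exists (val x); rewrite ?(valP x) // !inE eqxx.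
have : #|supp m| <= #|supp m1|; last by rewrite leqNgt lt.
apply: mmin; split=> //.
  by rewrite sm1E; apply: subset_trans (subsetDl _ _) sub.
have m1m : supp m1 \subset supp m by rewrite sm1E subsetDl.
apply: (matchable_setD m1m sub rest).
have -> : supp m :\: supp m1 = [set val x; val y].
  rewrite sm1E setDDr setDv set0U; apply/setIidPr/subsetP => v.
  by rewrite in_set2 => /orP[]/eqP->; apply: valP.
have nv : val y == val x = false by rewrite val_eqE eq_sym (negbTE nxy).
exists (fun v => if v == val x then val y else if v == val y then val x else v).
  split=> v; case: (eqVneq v (val x)) => [->|vx].
  - by rewrite nv eqxx.
  - by case: (eqVneq v (val y)) => [->|vy]; rewrite ?eqxx // (negbTE vx) (negbTE vy).
  - by [].
  - by case: (eqVneq v (val y)) => [->|vy]; rewrite ?eqxx // adj_sym.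
apply/setP => v; rewrite !inE; case: (eqVneq v (val x)) => [->|vx]; first by rewrite nv.
by case: (eqVneq v (val y)) => [->|vy] /=; rewrite ?eqxx // eq_sym nv.
Qed.

Lemma KE_or_spans_posy S0 : matchable S0 ->
  [/\ KE (induced G S0) & has_perfect_matching (induced G S0)] \/
  exists m, spans_posy S0 m.
Proof.
move=> [m [K adjm] sm].
have stay (v : {v | v \in S0}) : m (val v) \in S0.
  by case: v => v /=; rewrite -sm !inE K eq_sym.
pose mu (v : {v | v \in S0}) : {v | v \in S0} := exist _ (m (val v)) (stay v).
have mm : mating (induced G S0) mu.
  split=> v; first by apply: val_inj; rewrite /= K.
  by apply: adjm; case: v => v /=; rewrite -sm inE.
have adj_val (v w : {v | v \in S0}) : induced G S0 v w -> G (val v) (val w) by [].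
have [KE0|[m1 [mm1 sm1 P]]] := KE_or_posy val_inj adj_val mm.
  by left; split=> //; exists (mate_edges mu); apply: mating_perfect.
right; exists m1.
have sE : supp m1 = S0.
  rewrite sm1; apply/setP => v; apply/imsetP/idP => [[w _ ->]|vS]; first exact: valP.
  by exists (Sub v vS).
split=> //; rewrite sE ?setDv //; exists id.
  by split=> // v; rewrite eqxx.
by apply/setP => v; rewrite !inE eqxx.
Qed.

Lemma Deming_parts S0 : matchable S0 -> exists (Bs Ks : seq {set V}) (R : {set V}),
  [/\ forall B, B \in Bs -> Deming_BP (induced G B),
      forall K, K \in Ks -> Deming_K4 (induced G K),
      KE (induced G R), has_perfect_matching (induced G R) &
      forall v, count (fun B : {set V} => v \in B) Bs +
        count (fun K : {set V} => v \in K) Ks + (v \in R) = (v \in S0)].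
Proof.
have [n] := ubnP #|S0|; elim: n S0 => // n IH S0; rewrite ltnS => cS0 mS0.
have [[KE0 pm0]|/least_posy] := KE_or_spans_posy mS0.
  by exists [::], [::], S0; split.
move=> [m [r [u [s [x [y [z [sp t mmin]]]]]]]].
have sub := least_posy_restr sp mmin; have del := least_posy_deletion sp mmin.
have [mm sS0 rest _] := sp.
have ltS : #|S0 :\: supp m| < n.
  apply: leq_trans cS0; apply: proper_card; rewrite properE subsetDl /=.
  apply/subsetPn; exists (x 0); last by rewrite !inE (tight_xsupp t).
  by apply: (subsetP sS0); rewrite inE (tight_xsupp t).
have [Bs [Ks [R [HB HK HR pR part]]]] := IH _ ltS rest.
have split_at v : (v \in S0 :\: supp m) + (v \in supp m) = (v \in S0).
  rewrite in_setD; have := subsetP sS0 v.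
  by case: (v \in supp m) => [/(_ isT) ->|_]; rewrite ?addn0.
case: (tight_subdivision t sub) => subdiv.
- exists (supp m :: Bs), Ks, R; split=> // [B|v].
    by rewrite inE => /orP[/eqP->|/HB].
  by rewrite -split_at -part /=; lia.
- exists Bs, (supp m :: Ks), R; split=> // [B|v].
    by rewrite inE => /orP[/eqP->|/HK].
  by rewrite -split_at -part /=; lia.
Qed.

End Decomposition.

Lemma card_nth_mem (V : finType) (Xs : seq {set V}) v :
  #|[set i : 'I_(size Xs) | v \in nth set0 Xs i]| = count (fun X : {set V} => v \in X) Xs.
Proof. by rewrite -sum1_count (big_nth set0) big_mkord sum1dep_card. Qed.

Unset Implicit Arguments.

Theorem mainTheorem1 (V : finType) (G : sgraph V) :
  has_perfect_matching G ->
  exists (r l : nat) (B : 'I_r -> {set V}) (K : 'I_l -> {set V}) (R : {set V}),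
    Deming_decomposition G B K R.
Proof.
move=> [M /perfect_matching_mating[m [K adjm] _]].
have mS : matchable G [set: V].
  exists m; first by split.
  apply/setP => v; rewrite !inE; apply/eqP => E.
  by have := adjm v; rewrite E adj_irr.
have [Bs [Ks [R [HB HK HR pR part]]]] := Deming_parts mS.
exists (size Bs), (size Ks), (fun i => nth set0 Bs i), (fun j => nth set0 Ks j), R.
split=> // [i|j|v].
- by apply: HB; apply: mem_nth.
- by apply: HK; apply: mem_nth.
- by rewrite !card_nth_mem part inE.
Qed.
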